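(* Let $T$ be a closed normal operator on a complex Hilbert space $H$ and let $A$ be a linear operator on $H$ with $\mathcal D(T)\subseteq\mathcal D(A)$ such that, for some constants $a\ge 0$ and $0\le b<\frac1{\sqrt5}$, $\|Ax\|^2\le a^2\|x\|^2+b^2\|Tx\|^2$ for all $x\in\mathcal D(T)$. Assume that there are unbounded real sequences $(\alpha_n)_{n\in\mathbb N}$ and $(\beta_n)_{n\in\mathbb N}$ such that $\alpha_n<\beta_n\le\alpha_{n+1}$ and $\{z\in\mathbb C:\alpha_n<\operatorname{Re} z<\beta_n\}\subseteq\rho(T)$ for every $n$. Put $$q_n=\frac{2\sqrt{\frac{a^2+b^2\beta_n^2}{1-b^2}}}{\beta_n-\alpha_n}.$$ (i) If $\liminf_{n\to\infty}q_n<1$, then $\rho(T+A)$ contains infinitely many rectangular regions around real intervals, in the sense that for infinitely many $n$ there are $\alpha_n\le\alpha<\beta\le\beta_n$ and $\epsilon>0$ with $\{z\in\mathbb C:\alpha<\operatorname{Re} z<\beta,\ -\epsilon<\operatorname{Im} z<\epsilon\}\subseteq\rho(T+A)$. If $b=0$, then $\liminf_{n\to\infty}q_n<1$ holds if and only if $\limsup_{n\to\infty}(\beta_n-\alpha_n)>2a$; if $0<b<\frac1{\sqrt5}$, it holds if and only if $$\limsup_{n\to\infty}\frac{\beta_n}{\alpha_n}>1+\frac{2b}{\sqrt{1-b^2}-2b}.$$ (ii) If $\limsup_{n\to\infty}q_n<1$, then at most finitely many of the spectral gaps of $T$ disappear completely, i.e. for all but finitely many $n$ there are $\alpha_n\le\alpha<\beta\le\beta_n$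 and $\epsilon>0$ with $\{z\in\mathbb C:\alpha<\operatorname{Re} z<\beta,\ -\epsilon<\operatorname{Im} z<\epsilon\}\subseteq\rho(T+A)$. If $b=0$, then $\limsup_{n\to\infty}q_n<1$ holds if and only if $\liminf_{n\to\infty}(\beta_n-\alpha_n)>2a$; if $0<b<\frac1{\sqrt5}$, it holds if and only if $$\liminf_{n\to\infty}\frac{\beta_n}{\alpha_n}>1+\frac{2b}{\sqrt{1-b^2}-2b}.$$
   Context: $\mathcal D(S)$ denotes the domain of an operator $S$. A closed densely defined operator $T$ on $H$ is normal if $TT^*=T^*T$. The operator $T+A$ has domain $\mathcal D(T)$. The resolvent set $\rho(S)$ is the set of $z\in\mathbb C$ such that $S-z:\mathcal D(S)\to H$ is bijective with bounded inverse; $\sigma(S)=\mathbb C\setminus\rho(S)$. Limits superior and inferior take values in $[-\infty,\infty]$; note $\alpha_n\to+\infty$, so $\beta_n/\alpha_n$ is defined for all large $n$.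
   Formalization: For b=0, the implications from liminf q_n<1 (resp. limsup q_n<1) to limsup (resp. liminf) of β_n−α_n being >2a are stated only for a>0; for a=b=0 they fail, since q_n=0 while gap lengths may tend to 0 (e.g. T=A=0 on ℂ). The converses hold for all a≥0. *)

(* Defs.v *)
From HB Require Import structures.
From mathcomp Require Import all_boot all_order all_algebra sesquilinear.
From mathcomp Require Import complex.
From mathcomp Require Import all_classical all_reals all_analysis.

Set Implicit Arguments.
Unset Strict Implicit.
Unset Printing Implicit Defensive.

Import Order.TTheory GRing.Theory Num.Theory Num.Def.
Import numFieldNormedType.Exports.

Local Open Scope classical_set_scope.
Local Open Scope ring_scope.
Local Open Scope complex_scope.

(* A possibly unbounded operator on H is a domain together with a total       *)
(* function whose values outside the domain are irrelevant; accordingly,      *)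
(* operators are compared with eq_operator, not with Leibniz equality.        *)
Record operator (H : Type) := Operator { dom : set H ; opfun :> H -> H }.

Definition eq_operator (H : Type) (S1 S2 : operator H) : Prop :=
  dom S1 = dom S2 /\ (forall x, dom S1 x -> S1 x = S2 x).

Definition comp_operator (H : Type) (S1 S2 : operator H) : operator H :=
  Operator [set x | dom S2 x /\ dom S1 (S2 x)] (fun x => S1 (S2 x)).

Section Operators.
Variables (R : realType) (H : completeNormedModType R[i]).
Implicit Types (S T A : operator H) (z : R[i]).

Definition linear_operator S : Prop :=
  dom S 0 /\
  (forall (c : R[i]) x y, dom S x -> dom S y ->
     dom S (c *: x + y) /\ S (c *: x + y) = c *: S x + S y).

Definition closed_operator S : Prop :=
  closed [set p : H * H | dom S p.1 /\ p.2 = S p.1].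

Definition add_operator T A : operator H :=
  Operator (dom T) (fun x => T x + A x).

(* The form dot is linear in its first argument. When dom S is dense, the     *)
(* vector w below is unique, so that xget returns the value of the adjoint.   *)
Definition adjoint (dot : {dot H for conjC}) S : operator H :=
  Operator
    [set y | exists w, forall x, dom S x -> dot (S x) y = dot x w]
    (fun y => xget 0 [set w | forall x, dom S x -> dot (S x) y = dot x w]).

Definition normal_operator (dot : {dot H for conjC}) T : Prop :=
  [/\ linear_operator T, closed_operator T, dense (dom T)
    & eq_operator (comp_operator T (adjoint dot T))
                  (comp_operator (adjoint dot T) T)].

(* V is the inverse of the bijection S - z from dom S onto H. *)
Definition resolvent_set S : set R[i] :=
  [set z | exists V : H -> H,
     [/\ forall y, dom S (V y),
         forall y, S (V y) - z *: V y = y,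
         forall x, dom S x -> V (S x - z *: x) = x
       & exists M : R, forall y, `|V y| <= M%:C * `|y| ]].

Definition strip (al be : R) : set R[i] :=
  [set z | al < complex.Re z < be].

Definition rectangle (al be eps : R) : set R[i] :=
  [set z | al < complex.Re z < be /\ - eps < complex.Im z < eps].

Definition gap_survives S (al be : R) : Prop :=
  exists al' be' eps : R,
    [/\ al <= al', al' < be', be' <= be, 0 < eps
      & rectangle al' be' eps `<=` resolvent_set S].

End Operators.

Definition gap_quotient (R : realType) (a b al be : R) : R :=
  2 * Num.sqrt ((a ^+ 2 + b ^+ 2 * be ^+ 2) / (1 - b ^+ 2)) / (be - al).

(* Main.v *)
Require Import Defs.
From HB Require Import structures.
From mathcomp Require Import all_boot all_order all_algebra sesquilinear.
From mathcomp Require Import complex ring lra.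
From mathcomp Require Import all_classical all_reals all_analysis.

Set Implicit Arguments.
Unset Strict Implicit.
Unset Printing Implicit Defensive.

Import Order.TTheory GRing.Theory Num.Theory Num.Def.
Import numFieldNormedType.Exports.

Local Open Scope classical_set_scope.
Local Open Scope ring_scope.
Local Open Scope complex_scope.

(** For real [w] and [B < 1], completing the square gives, on the domain of [T],
      |(T - (1 - B) w) u|^2
        = B |T u|^2 + (1 - B) (|(T - w) u|^2 - B w^2 |u|^2).
    Let [w] be the midpoint of a gap and [r] half its length. Since [T] is normal
    and the disc of radius [r] around [w] is free of spectrum,
    |(T - w) u| >= r |u|. The condition q < 1 reads
    a^2 + b^2 be^2 < (1 - b^2) r^2, where [be] is the right end of the gap; it
    leaves room to take [B] slightly larger than [b ^+ 2], and then the right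
    hand side above is at least kap (a^2 |u|^2 + b^2 |T u|^2) for some kap > 1.
    Hence |A u| <= k |(T - x0) u| with k < 1 at the point x0 = (1 - B) w of the
    gap ([gap_margin], [gap_survives_perturbation]), and a contraction argument
    puts a neighbourhood of x0 into the resolvent set of [T + A]
    ([resolvent_perturbation]).

    The bound |(T - w) u| >= r |u| ([normal_bounded_below]) is obtained without
    the spectral theorem. On the domain of T*T, which is a core of [T] by two
    orthogonal projections in the graph ([graph_core]), normality gives
    |T* x| = |T x|; therefore [T - w] is hyponormal ([hyponormal]) and its
    inverse N satisfies |N y|^2 <= |N (N y)| |y|. Suppose that |N| > 1 / r and
    rescale N to a contraction U of norm one. Then U - om is bounded below by
    some c > 0, uniformly in |om| = 1, because the closed disc of radius 1 / |N|
    around [w] consists of resolvent points and is compact. Factoring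
    U^(2n) - om^2 = (U^n - om) (U^n + om) and using the parallelogram law, this
    bound improves at each doubling ([iter_sub_unimodular_ge]):
      |(U^n - om) y|^2 >= c^2 (|y|^2 + |U y|^2 + ... + |U^(n-1) y|^2),
    for n a power of two. As the left hand side is at most 4 |y|^2 and the terms
    on the right decrease, |U^n y| <= |y| / 2 for n large. The inequality for N
    makes |U y|^n <= |U^n y| |y|^(n-1), so |U| < 1, which is absurd
    ([contraction_improve]).

    The equivalences compare limits of real sequences: since beta_n tends to
    infinity, q_n is asymptotic to 2 b / (sqrt (1 - b^2) (1 - alpha_n / beta_n))
    when [0 < b], and it equals 2 a / (beta_n - alpha_n) when [b = 0]. *)

(** * Limits inferior and superior of real sequences *)

Definition infinitely_often (P : nat -> Prop) : Prop :=
  forall N, exists2 n, (N <= n)%N & P n.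

Lemma infinitely_oftenS (P Q : nat -> Prop) :
  (\forall n \near \oo, P n -> Q n) -> infinitely_often P -> infinitely_often Q.
Proof.
move=> [M _ PQ] oP N; have [n Nn Pn] := oP (maxn M N).
move: Nn; rewrite geq_max => /andP[Mn Nn].
by exists n => //; exact: PQ.
Qed.

Lemma infinitely_often_infinite (P : nat -> Prop) :
  infinitely_often P -> infinite_set [set n | P n].
Proof.
move=> oP /finite_seqP[s Ps].
have [n sn Pn] := oP (\max_(i <- s) i).+1.
have : n \in s by have : [set n | P n] n := Pn; rewrite Ps.
by move=> ns; move: sn; rewrite ltnNge leq_bigmax_seq.
Qed.

Lemma eventually_finite (P : nat -> Prop) :
  (\forall n \near \oo, P n) -> finite_set [set n | ~ P n].
Proof.
move=> [N _ PN]; apply: (@sub_finite_set _ _ `I_N); last exact: finite_II.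
by move=> n /= nPn; rewrite ltnNge; apply/negP => Nn; apply: nPn; exact: PN.
Qed.

Section Limits.
Variable R : realType.
Implicit Types (u v : R^nat) (x y : R).

Lemma limn_esup_le u y :
  (\forall n \near \oo, u n <= y) -> (limn_esup (fun n => (u n)%:E) <= y%:E)%E.
Proof.
move=> uy; rewrite /limn_esup limf_esupE.
apply: (@le_trans _ _ (ereal_sup [set (u n)%:E | n in [set n | u n <= y]])).
  by apply: ereal_inf_lbound; exists [set n | u n <= y].
by apply: ge_ereal_sup => _ [n /= un <-]; rewrite lee_fin.
Qed.

Lemma limn_esup_ltP u x : (limn_esup (fun n => (u n)%:E) < x%:E)%E <->
  exists2 y, y < x & \forall n \near \oo, u n < y.
Proof.
split=> [|[y yx uy]]; last first.
  apply: (@le_lt_trans _ _ y%:E); last by rewrite lte_fin.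
  by apply: limn_esup_le; apply: filterS uy => n /ltW.
rewrite /limn_esup limf_esupE => /ereal_inf_lt[_ [V oV <-]] sx.
have [y sy yx] : exists2 y, (ereal_sup [set (u n)%:E | n in V] < y%:E)%E & y < x.
  case: (ereal_sup _) sx => [r| |] //.
    by rewrite lte_fin => rx; exists ((r + x) / 2); rewrite ?lte_fin; lra.
  by move=> _; exists (x - 1); rewrite ?ltNyr//; lra.
exists y => //; apply: filterS oV => n Vn.
by rewrite -lte_fin; apply: le_lt_trans sy; apply: ereal_sup_ubound; exists n.
Qed.

Lemma limn_esup_gtP u x : (x%:E < limn_esup (fun n => (u n)%:E))%E <->
  exists2 y, x < y & infinitely_often (fun n => y < u n).
Proof.
split=> [xl|[y xy oy]]; last first.
  rewrite ltNge; apply/negP => lx.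
  have : (limn_esup (fun n => (u n)%:E) < y%:E)%E.
    by apply: le_lt_trans lx _; rewrite lte_fin.
  move=> /limn_esup_ltP[z zy [N _ Nz]].
  have [n Nn yn] := oy N.
  by have := lt_trans yn (lt_trans (Nz n Nn) zy); rewrite ltxx.
have [y xy yl] : exists2 y, x < y & (y%:E < limn_esup (fun n => (u n)%:E))%E.
  case: (limn_esup _) xl => [r| |] //.
    by rewrite lte_fin => xr; exists ((x + r) / 2); rewrite ?lte_fin; lra.
  by move=> _; exists (x + 1); rewrite ?ltry//; lra.
exists y => // N; apply: contrapT => nN.
move: yl; apply/negP; rewrite -leNgt; apply: limn_esup_le.
exists N => // n /= Nn; rewrite leNgt; apply/negP => yn.
by apply: nN; exists n.
Qed.

Lemma limn_einf_esupN u : limn_einf (fun n => (u n)%:E) =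
  (- limn_esup (fun n => (- u n)%:E))%E.
Proof. by []. Qed.

Lemma limn_einf_ltP u x : (limn_einf (fun n => (u n)%:E) < x%:E)%E <->
  exists2 y, y < x & infinitely_often (fun n => u n < y).
Proof.
rewrite limn_einf_esupN lteNl -EFinN (limn_esup_gtP (fun n => - u n)).
split=> -[y xy oy]; exists (- y); rewrite 1?ltrNl ?opprK// 1?ltrNr//.
all: move=> N; have [n Nn un] := oy N; exists n => //.
  by rewrite ltrNr.
by rewrite ltrN2.
Qed.

Lemma limn_einf_gtP u x : (x%:E < limn_einf (fun n => (u n)%:E))%E <->
  exists2 y, x < y & \forall n \near \oo, y < u n.
Proof.
rewrite limn_einf_esupN lteNr -EFinN (limn_esup_ltP (fun n => - u n)).
split=> -[y xy oy]; exists (- y); rewrite 1?ltrNl ?opprK// 1?ltrNr//.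
all: apply: filterS oy => n.
  by rewrite ltrNl.
by rewrite ltrN2.
Qed.

(** Only a strict bound with a margin passes to the limit, hence the moving
    thresholds [x'] and [y']. *)
Lemma limn_lt_gt u v x y :
  (forall x', x' < x -> exists2 y', y < y' &
     \forall n \near \oo, u n < x' -> y' < v n) ->
  ((limn_einf (fun n => (u n)%:E) < x%:E)%E ->
     (y%:E < limn_esup (fun n => (v n)%:E))%E) /\
  ((limn_esup (fun n => (u n)%:E) < x%:E)%E ->
     (y%:E < limn_einf (fun n => (v n)%:E))%E).
Proof.
move=> uv; split=> [/limn_einf_ltP|/limn_esup_ltP] [x' /uv[y' yy' xy'] ux'].
  by apply/limn_esup_gtP; exists y' => //; exact: infinitely_oftenS ux'.
by apply/limn_einf_gtP; exists y' => //; apply: filterS2 ux' xy' => n un; exact.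
Qed.

Lemma limn_gt_lt u v x y :
  (forall y', y < y' -> exists2 x', x' < x &
     \forall n \near \oo, y' < v n -> u n < x') ->
  ((y%:E < limn_esup (fun n => (v n)%:E))%E ->
     (limn_einf (fun n => (u n)%:E) < x%:E)%E) /\
  ((y%:E < limn_einf (fun n => (v n)%:E))%E ->
     (limn_esup (fun n => (u n)%:E) < x%:E)%E).
Proof.
move=> uv; split=> [/limn_esup_gtP|/limn_einf_gtP] [y' /uv[x' xx' xy'] vy'].
  by apply/limn_einf_ltP; exists x' => //; exact: infinitely_oftenS vy'.
by apply/limn_esup_ltP; exists x' => //; apply: filterS2 vy' xy' => n vn; exact.
Qed.

End Limits.

(** * Asymptotics of the gap quotients *)

Section GapQuotient.
Variables (R : realType) (a b : R) (alpha beta : R^nat).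
Hypotheses (a_ge0 : 0 <= a) (b_ge0 : 0 <= b) (b_lt : b < 1 / Num.sqrt 5).
Hypothesis alpha_unbounded : ~ bounded_fun alpha.
Hypothesis alpha_lt_beta : forall n : nat, alpha n < beta n.
Hypothesis beta_le_alpha : forall n : nat, beta n <= alpha n.+1.

Lemma sqr_bound_lt : 5 * b ^+ 2 < 1.
Proof.
have s0 : 0 < Num.sqrt (5 : R) by rewrite sqrtr_gt0.
have : b * Num.sqrt 5 < 1 by rewrite -ltr_pdivlMr.
move=> b5; have b50 : 0 <= b * Num.sqrt 5 by rewrite mulr_ge0// ltW.
have : (b * Num.sqrt 5) ^+ 2 < 1 by rewrite expr_lt1.
by rewrite exprMn sqr_sqrtr// mulrC.
Qed.

Lemma alpha_gt_near M : \forall n \near \oo, M < alpha n.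
Proof.
have alpha_nd : nondecreasing_seq alpha.
  apply/nondecreasing_seqP => n.
  exact: le_trans (ltW (alpha_lt_beta n)) (beta_le_alpha n).
have [N MN] : exists N, M < alpha N.
  apply: contrapT => /forallNP nM; apply: alpha_unbounded => /=.
  exists (`|alpha 0| + `|M|); split; first exact: num_real.
  move=> K lK n _ /=; apply: le_trans (ltW lK).
  have /negP := nM n; rewrite -leNgt => aM.
  have := alpha_nd 0%N n (leq0n n) => a0.
  have := ler_norm M; have := ler_norm (- alpha 0); rewrite normrN => ? ?.
  have ? := normr_ge0 M; have ? := normr_ge0 (alpha 0).
  by rewrite ler_norml; apply/andP; split; lra.
by exists N => // n /= Nn; apply: lt_le_trans MN (alpha_nd _ _ Nn).
Qed.

Lemma gap_quotient_b0 al be : b = 0 -> gap_quotient a b al be = 2 * a / (be - al).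
Proof.
move=> b0; rewrite /gap_quotient b0 expr0n /= mul0r subr0 addr0 divr1.
by rewrite sqrtr_sqr ger0_norm.
Qed.

Lemma gap_quotientE al be : gap_quotient a b al be =
  2 * Num.sqrt (a ^+ 2 + b ^+ 2 * be ^+ 2) / (Num.sqrt (1 - b ^+ 2) * (be - al)).
Proof.
have b1 : 0 <= 1 - b ^+ 2 by have := sqr_bound_lt; have := sqr_ge0 b; lra.
have ab0 : 0 <= a ^+ 2 + b ^+ 2 * be ^+ 2.
  by rewrite -exprMn addr_ge0 ?sqr_ge0.
by rewrite /gap_quotient sqrtrM// sqrtrV// invfM !mulrA.
Qed.

Let s := Num.sqrt (1 - b ^+ 2).

Lemma double_bound_lt : 2 * b < s.
Proof.
have b5 := sqr_bound_lt; have b2 := sqr_ge0 b.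
rewrite /s -[2 * b]ger0_norm; last by rewrite mulr_ge0.
rewrite -sqrtr_sqr ltr_sqrt; first by rewrite exprMn; lra.
lra.
Qed.

Let q n := gap_quotient a b (alpha n) (beta n).

(** The threshold [x] is first raised above [0], so that dividing by it is
    harmless. *)
Lemma quotient_lt_length_gt : b = 0 -> 0 < a -> forall x, x < 1 ->
  exists2 y, 2 * a < y & \forall n \near \oo, q n < x -> y < beta n - alpha n.
Proof.
move=> b0 a0 x x1; pose x' := maxr x (1 / 2).
have x'0 : 0 < x' by rewrite lt_max; apply/orP; right; lra.
have x'1 : x' < 1 by rewrite gt_max x1; lra.
exists (2 * a / x').
  by rewrite ltr_pdivlMr// gtr_pMr// mulr_gt0.
apply: nearW => n; rewrite /q gap_quotient_b0// => qx.
have d0 : 0 < beta n - alpha n by rewrite subr_gt0.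
rewrite ltr_pdivrMr// [ltRHS]mulrC -ltr_pdivrMr//.
by apply: lt_le_trans qx _; rewrite le_max lexx.
Qed.

Lemma length_gt_quotient_lt : b = 0 -> forall y, 2 * a < y ->
  exists2 x, x < 1 & \forall n \near \oo, y < beta n - alpha n -> q n < x.
Proof.
move=> b0 y ay; have y0 : 0 < y by have := a_ge0; lra.
pose t := 2 * a / y.
have t1 : t < 1 by rewrite /t ltr_pdivrMr// mul1r.
exists ((1 + t) / 2); first lra.
apply: nearW => n yn; rewrite /q gap_quotient_b0//.
have : 2 * a / (beta n - alpha n) <= t; last by lra.
apply: ler_wpM2l; first by rewrite mulr_ge0.
by rewrite lef_pV2 ?posrE//; lra.
Qed.

(** Replacing [a] by [0] decreases [q], and for [a = 0] the condition [q n < x]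
    solves to an explicit lower bound on the ratio. That bound is positive and
    finite only if [x * s] exceeds [2 * b], so [x] is first raised to satisfy
    this. *)
Lemma quotient_lt_ratio_gt : 0 < b -> forall x, x < 1 ->
  exists2 y, 1 + 2 * b / (s - 2 * b) < y &
    \forall n \near \oo, q n < x -> y < beta n / alpha n.
Proof.
move=> b0 x x1; have bs := double_bound_lt; have s0 : 0 < s by lra.
pose t := 2 * b / s; pose x' := maxr x ((1 + t) / 2).
have t1 : t < 1 by rewrite /t ltr_pdivrMr// mul1r.
have x'1 : x' < 1 by rewrite gt_max x1; lra.
have x's : 2 * b < x' * s.
  by rewrite -ltr_pdivrMr// -/t lt_max; apply/orP; right; lra.
exists (1 + 2 * b / (x' * s - 2 * b)).
  rewrite ltrD2l ltr_pM2l ?mulr_gt0// ltf_pV2 ?posrE ?subr_gt0//.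
  by rewrite ltrD2r gtr_pMl.
apply: filterS (alpha_gt_near 0) => n an qx; have abn := alpha_lt_beta n.
have d0 : 0 < beta n - alpha n by rewrite subr_gt0.
have : q n < x' by apply: lt_le_trans qx _; rewrite le_max lexx.
rewrite /q gap_quotientE -/s ltr_pdivrMr; last by rewrite mulr_gt0.
move=> lt1.
have le1 : 2 * (b * beta n) <= 2 * Num.sqrt (a ^+ 2 + b ^+ 2 * beta n ^+ 2).
  rewrite ler_pM2l// -[b * _]ger0_norm; last by rewrite mulr_ge0//; lra.
  by rewrite -sqrtr_sqr ler_sqrt -?exprMn ?lerDr ?addr_ge0 ?sqr_ge0.
rewrite ltr_pdivlMr// -subr_gt0.
have -> : beta n - (1 + 2 * b / (x' * s - 2 * b)) * alpha n =
  ((x' * s - 2 * b) * (beta n - alpha n) - 2 * b * alpha n) / (x' * s - 2 * b).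
  by field; lra.
apply: divr_gt0; last by rewrite subr_gt0.
have := le_lt_trans le1 lt1; nra.
Qed.

(** Here [a] costs at most [a / beta n] relative to the case [a = 0], which is
    negligible for large [n] and is absorbed by half the distance of the
    limiting quotient to [1]. *)
Lemma ratio_gt_quotient_lt : 0 < b -> forall y, 1 + 2 * b / (s - 2 * b) < y ->
  exists2 x, x < 1 & \forall n \near \oo, y < beta n / alpha n -> q n < x.
Proof.
move=> b0 y yc; have bs := double_bound_lt; have s0 : 0 < s by lra.
have y1 : 1 < y.
  by apply: lt_trans yc; rewrite ltrDl divr_gt0 ?mulr_gt0// subr_gt0.
(* [k] is the limit that [q] would have if the ratio were exactly [y]. *)
pose k := 2 * b * y / (s * (y - 1)).
have sy0 : 0 < s * (y - 1) by rewrite mulr_gt0// subr_gt0.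
have k1 : k < 1.
  rewrite /k ltr_pdivrMr// mul1r; move: yc; rewrite -ltrBrDl.
  by rewrite ltr_pdivrMr ?subr_gt0//; nra.
exists ((1 + k) / 2); first lra.
have M0 : 0 < (1 - k) / 2 * (s * (y - 1)) by rewrite mulr_gt0//; lra.
apply: filterS2 (alpha_gt_near 0)
  (alpha_gt_near (2 * a * y / ((1 - k) / 2 * (s * (y - 1))))) => n an aM.
rewrite ltr_pdivlMr// => yn; have abn := alpha_lt_beta n.
have d0 : 0 < beta n - alpha n by rewrite subr_gt0.
rewrite /q gap_quotientE -/s ltr_pdivrMr; last by rewrite mulr_gt0.
have be0 : 0 < beta n by lra.
have le1 : Num.sqrt (a ^+ 2 + b ^+ 2 * beta n ^+ 2) <= a + b * beta n.
  have ab0 : 0 <= a + b * beta n by rewrite addr_ge0 ?mulr_ge0// ltW.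
  rewrite -[leRHS]ger0_norm// -sqrtr_sqr ler_sqrt ?sqr_ge0//.
  have := mulr_ge0 a_ge0 (mulr_ge0 b_ge0 (ltW be0)); nra.
have lt2 : 2 * a * y < beta n * ((1 - k) / 2 * (s * (y - 1))).
  by rewrite -ltr_pdivrMr//; exact: lt_trans aM abn.
have ek : k * (s * (y - 1)) = 2 * b * y by rewrite /k divfK// lt0r_neq0.
have lt3 : (y - 1) * beta n < y * (beta n - alpha n) by nra.
have : y * (2 * (a + b * beta n)) < y * ((1 + k) / 2 * (s * (beta n - alpha n))).
  have k0 : 0 < (1 + k) / 2 * s.
    by rewrite mulr_gt0// divr_gt0// addr_gt0// divr_gt0// !mulr_gt0//; exact: lt_trans y1.
  apply: (@lt_trans _ _ ((1 + k) / 2 * s * ((y - 1) * beta n))).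
    have -> : y * (2 * (a + b * beta n)) = 2 * a * y + 2 * b * y * beta n by ring.
    rewrite -ek; nra.
  have -> : y * ((1 + k) / 2 * (s * (beta n - alpha n))) =
     (1 + k) / 2 * s * (y * (beta n - alpha n)) by ring.
  by rewrite ltr_pM2l.
rewrite ltr_pM2l; last lra.
move=> /(le_lt_trans _); apply; lra.
Qed.

End GapQuotient.

(** * Orthogonal projection for a real inner product *)

(** A complex Hilbert space is treated as a real one: the real part of its inner
    product already determines the norm, and the graph of an operator carries
    the sum of two such forms. *)
Definition real_inner (R : realType) (V : lmodType R[i]) (ip : V -> V -> R) :=
  [/\ forall x y z, ip (x + y) z = ip x z + ip y z,
      forall (t : R) x y, ip (t%:C *: x) y = t * ip x y,
      forall x y, ip x y = ip y x
    & forall x, 0 <= ip x x].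

(** Membership of [q] in the closure of [L], for a norm [n] that need not be the
    one of a normed module instance. *)
Definition approx_by (R : realType) (V : zmodType) (n : V -> R) (L : set V) q :=
  forall e, 0 < e -> exists2 p, L p & n (p - q) < e.

Definition complete_for (R : realType) (V : zmodType) (n : V -> R) :=
  forall p : nat -> V,
  (forall e, 0 < e -> exists N, forall j k, (N <= j)%N -> (N <= k)%N ->
     n (p j - p k) < e) ->
  exists l, forall e, 0 < e -> exists N, forall k, (N <= k)%N -> n (p k - l) < e.

Section RealInner.
Variables (R : realType) (V : lmodType R[i]) (ip : V -> V -> R).
Hypothesis ip_inner : real_inner ip.
Implicit Types (x y : V) (t : R).

Definition inorm x := Num.sqrt (ip x x).

Lemma ipDl x y z : ip (x + y) z = ip x z + ip y z.
Proof. by case: ip_inner. Qed.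
Lemma ipZl t x y : ip (t%:C *: x) y = t * ip x y.
Proof. by case: ip_inner. Qed.
Lemma ipC x y : ip x y = ip y x.
Proof. by case: ip_inner. Qed.
Lemma ip_ge0 x : 0 <= ip x x.
Proof. by case: ip_inner. Qed.
Lemma ipDr x y z : ip z (x + y) = ip z x + ip z y.
Proof. by rewrite !(ipC z) ipDl. Qed.
Lemma ipZr t x y : ip y (t%:C *: x) = t * ip y x.
Proof. by rewrite !(ipC y) ipZl. Qed.
Lemma ipNl x y : ip (- x) y = - ip x y.
Proof. by rewrite -scaleN1r -(rmorphN1 (real_complex R)) ipZl mulN1r. Qed.
Lemma ipNr x y : ip y (- x) = - ip y x.
Proof. by rewrite !(ipC y) ipNl. Qed.
Lemma ipBl x y z : ip (x - y) z = ip x z - ip y z.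
Proof. by rewrite ipDl ipNl. Qed.
Lemma ipBr x y z : ip z (x - y) = ip z x - ip z y.
Proof. by rewrite ipDr ipNr. Qed.

Lemma inorm_ge0 x : 0 <= inorm x. Proof. exact: sqrtr_ge0. Qed.
Lemma inorm2 x : inorm x ^+ 2 = ip x x.
Proof. by rewrite sqr_sqrtr// ip_ge0. Qed.

(** A quadratic polynomial in [t] that is minimal at [0] has no linear term; the
    form may be degenerate, so the test value of [t] has [1 + ip y y] as
    denominator. *)
Lemma ip_eq0_min x y : (forall t, ip x x <= ip (x + t%:C *: y) (x + t%:C *: y)) ->
  ip y x = 0.
Proof.
move=> xt; have yy := ip_ge0 y; apply/eqP; rewrite -sqrf_eq0.
have : ip y x ^+ 2 <= 0; last by rewrite le_eqVlt ltNge sqr_ge0 orbF.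
have := xt (- ip y x / (1 + ip y y)).
rewrite !(ipDl, ipDr, ipZl, ipZr) (ipC x y).
set d := ip y x; set c := ip y y in yy *; set t := - d / (1 + c).
rewrite [leRHS](_ : _ = ip x x + t * (2 * d + t * c)); last by ring.
rewrite lerDl.
have -> : t * (2 * d + t * c) = - (d ^+ 2 * (2 + c)) / (1 + c) ^+ 2.
  by rewrite /t; field; rewrite lt0r_neq0//; lra.
rewrite mulNr oppr_ge0 pmulr_lle0; last first.
  by rewrite invr_gt0 exprn_gt0//; lra.
rewrite pmulr_lle0//; lra.
Qed.


Lemma ip_CS x y : ip x y <= inorm x * inorm y.
Proof.
have xx := ip_ge0 x; have yy := ip_ge0 y.
have H t : 0 <= ip x x - 2 * t * ip x y + t ^+ 2 * ip y y.
  have := ip_ge0 (x - t%:C *: y).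
  rewrite !(ipBl, ipBr, ipZl, ipZr) (ipC y x).
  by congr (0 <= _); ring.
have [xy0|xy0] := leP (ip x y) 0.
  by apply: (le_trans xy0); rewrite mulr_ge0 ?inorm_ge0.
rewrite -(@ler_pXn2r _ 2) ?nnegrE ?mulr_ge0 ?inorm_ge0 ?(ltW xy0)//.
rewrite exprMn !inorm2.
move: yy; rewrite le_eqVlt => /predU1P[y0|y0].
  have := H ((ip x x + 1) / (2 * ip x y)); rewrite -y0 mulr0 addr0.
  have -> : 2 * ((ip x x + 1) / (2 * ip x y)) * ip x y = ip x x + 1.
    by field; rewrite lt0r_neq0.
  lra.
have := H (ip x y / ip y y).
have -> : ip x x - 2 * (ip x y / ip y y) * ip x y + (ip x y / ip y y) ^+ 2 * ip y y
  = (ip x x * ip y y - ip x y ^+ 2) / ip y y by field; rewrite lt0r_neq0.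
by rewrite pmulr_lge0 ?invr_gt0// subr_ge0.
Qed.

Lemma inorm_triangle x y : inorm (x + y) <= inorm x + inorm y.
Proof.
rewrite -(@ler_pXn2r _ 2) ?nnegrE ?addr_ge0 ?inorm_ge0//.
rewrite sqrrD !inorm2 !(ipDl, ipDr) (ipC y x).
have := ip_CS x y; lra.
Qed.

Lemma inormN x : inorm (- x) = inorm x.
Proof. by rewrite /inorm ipNl ipNr opprK. Qed.

Lemma inormB x y : inorm (x - y) = inorm (y - x).
Proof. by rewrite -opprB inormN. Qed.

Lemma parallelogram x y :
  inorm (x + y) ^+ 2 + inorm (x - y) ^+ 2 = 2 * (inorm x ^+ 2 + inorm y ^+ 2).
Proof. by rewrite !inorm2 !(ipDl, ipDr, ipNl, ipNr) (ipC y x); ring. Qed.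

Lemma midpoint_identity x y z : inorm (x - y) ^+ 2 =
  2 * (inorm (x - z) ^+ 2 + inorm (y - z) ^+ 2)
   - 4 * inorm (2^-1%:C *: x + 2^-1%:C *: y - z) ^+ 2.
Proof.
rewrite !inorm2 !(ipBl, ipBr) !(ipDl, ipDr, ipZl, ipZr).
by rewrite (ipC y x) (ipC z x) (ipC z y); field.
Qed.

(** By the parallelogram law a minimizing sequence for the distance to [p0] is
    Cauchy. As [L] is not assumed closed, the minimizer is only approximated by
    elements of [L], but it is still orthogonal to [L]. *)
Lemma orthogonal_projection (L : set V) p0 :
  complete_for inorm -> L 0 ->
  (forall t x y, L x -> L y -> L (t%:C *: x + y)) ->
  exists2 q, approx_by inorm L q & forall v, L v -> ip v (q - p0) = 0.
Proof.
move=> Vcomplete L0 Llin.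
pose E := [set inorm (p - p0) | p in L].
have E0 : has_inf E.
  split; first by exists (inorm (0 - p0)), 0.
  by exists 0 => _ [p _ <-]; exact: inorm_ge0.
pose d := inf E.
have dle p : L p -> d <= inorm (p - p0).
  by move=> Lp; apply: ge_inf; [case: E0|exists p].
have d0 : 0 <= d.
  by apply: lb_le_inf; [case: E0|move=> _ [p _ <-]; exact: inorm_ge0].
have /choice[p pP] (k : nat) : exists p, L p /\ inorm (p - p0) < d + k.+1%:R^-1.
  have [_ [p Lp <-] pd] := @inf_adherent _ E k.+1%:R^-1 ltac:(by []) E0.
  by exists p.
have near_d e : 0 < e -> exists N, forall k, (N <= k)%N -> inorm (p k - p0) < d + e.
  move=> e0; have [N _ Ne] := near_infty_natSinv_lt (PosNum e0).
  exists N => k Nk; apply: lt_trans (pP k).2 _.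
  by rewrite ltrD2l; exact: Ne.
have [q qP] : exists q, forall e, 0 < e -> exists N, forall k, (N <= k)%N ->
    inorm (p k - q) < e.
  apply: Vcomplete => e e0.
  (* If p j and p k are within d + eta of p0, then |p j - p k|^2 is at most
     4 ((d + eta)^2 - d^2) <= 4 eta (2 d + 1), using eta <= 1. *)
  pose eta := minr 1 (e ^+ 2 / (8 * (2 * d + 1))).
  have D0 : 0 < 8 * (2 * d + 1) by lra.
  have eta0 : 0 < eta by rewrite lt_min ltr01 divr_gt0// exprn_gt0.
  have eta1 : eta <= 1 by rewrite ge_min lexx.
  have etae : eta * (8 * (2 * d + 1)) <= e ^+ 2.
    by rewrite -ler_pdivlMr// ge_min lexx orbT.
  have [N NP] := near_d _ eta0; exists N => j k Nj Nk.
  rewrite -(@ltr_pXn2r _ 2) ?nnegrE ?inorm_ge0 ?ltW//.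
  rewrite (midpoint_identity _ _ p0).
  have Lmid : L (2^-1%:C *: p j + 2^-1%:C *: p k).
    apply: (Llin); first exact: (pP j).1.
    by rewrite -[_ *: _]addr0; apply: Llin => //; exact: (pP k).1.
  have dm := dle _ Lmid; have := NP _ Nj; have := NP _ Nk.
  have := inorm_ge0 (p j - p0); have := inorm_ge0 (p k - p0).
  nra.
exists q.
  by move=> e /qP[N NP]; exists (p N); [exact: (pP N).1|exact: NP].
have qd : inorm (q - p0) <= d.
  apply/ler_addgt0Pr => e e0.
  have e2 : 0 < e / 2 by rewrite divr_gt0.
  have [N1 N1P] := near_d _ e2; have [N2 N2P] := qP _ e2.
  have := N1P _ (leq_maxl N1 N2); have := N2P _ (leq_maxr N1 N2).
  set k := maxn N1 N2.
  have := inorm_triangle (q - p k) (p k - p0).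
  by rewrite subrKA (inormB q (p k)); lra.
have dq v t : L v -> d <= inorm (q - p0 + t%:C *: v).
  move=> Lv; apply/ler_addgt0Pr => e /qP[N /(_ N (leqnn N)) Ne].
  have := dle (t%:C *: v + p N) (Llin _ _ _ Lv (pP N).1).
  have -> : t%:C *: v + p N - p0 = (q - p0 + t%:C *: v) + (p N - q).
    by rewrite [RHS]addrC [RHS]addrA subrKA -addrA [LHS]addrC.
  have := inorm_triangle (q - p0 + t%:C *: v) (p N - q); lra.
move=> v Lv; apply: ip_eq0_min => t; rewrite -!inorm2.
by rewrite ler_pXn2r ?nnegrE ?inorm_ge0//; apply: le_trans (dq _ _ Lv).
Qed.

End RealInner.

(** * The norm and the inner product of a Hilbert space as real quantities *)

Section RealNorm.
Variables (R : realType) (V : normedModType R[i]).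
Implicit Types (x y : V) (c : R[i]).

Definition rnorm (x : V) : R := complex.Re `|x|.

Lemma rnormE x : `|x| = (rnorm x)%:C.
Proof. by rewrite /rnorm RRe_real// normr_real. Qed.

Lemma rnorm_ge0 x : 0 <= rnorm x.
Proof. by rewrite -ler0c -rnormE. Qed.

Lemma rnorm0_eq0 x : rnorm x = 0 -> x = 0.
Proof. by move=> x0; apply/normr0_eq0; rewrite rnormE x0. Qed.

Lemma rnorm_triangle x y : rnorm (x + y) <= rnorm x + rnorm y.
Proof. by rewrite -lecR rmorphD /= -!rnormE ler_normD. Qed.

Lemma rnormN x : rnorm (- x) = rnorm x.
Proof. by rewrite /rnorm normrN. Qed.

Lemma rnorm0 : rnorm 0 = 0.
Proof. by rewrite /rnorm normr0. Qed.

Lemma rnormZ c x : rnorm (c *: x) = complex.Re `|c| * rnorm x.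
Proof.
by apply/complexI; rewrite -rnormE normrZ rmorphM /= -rnormE.
Qed.

Lemma rnormZ_real (t : R) x : rnorm (t%:C *: x) = `|t| * rnorm x.
Proof.
by rewrite rnormZ normc_def /= expr0n /= addr0 sqrtr_sqr.
Qed.

Lemma rnormB x y : rnorm (x - y) = rnorm (y - x).
Proof. by rewrite -opprB rnormN. Qed.

Lemma rnorm_triangleB x y : rnorm x - rnorm y <= rnorm (x - y).
Proof. by rewrite lerBlDr -{1}(subrK y x) rnorm_triangle. Qed.

End RealNorm.

Section RealNormComplete.
Variables (R : realType) (H : completeNormedModType R[i]).

Lemma rnorm_complete : complete_for (@rnorm R H).
Proof.
move=> p pcauchy.
have : cvg (p @ \oo).
  apply/cauchy_cvgP/cauchy_ballP => e e0; near_simpl.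
  have Re0 : 0 < complex.Re e by move: e0; rewrite ltcE => /andP[].
  have [N NP] := pcauchy _ Re0.
  exists ([set k | N <= k]%N, [set k | N <= k]%N); first by split; exists N.
  move=> [j k] [/= Nj Nk]; rewrite -ball_normE /= rnormE.
  by rewrite -(RRe_real (gtr0_real e0)) ltcR; exact: NP.
move=> /cvg_ex[l pl]; exists l => e e0.
have ec0 : 0 < e%:C by rewrite ltcR.
have /cvgrPdist_lt/(_ _ ec0)[N _ NP] := pl.
exists N => k Nk; rewrite rnormB -ltcR -rnormE; exact: NP.
Qed.

Lemma linear_op0 (T : operator H) : linear_operator T -> T 0 = 0.
Proof.
move=> [T0 Tlin]; have [_] := Tlin 1 0 0 T0 T0.
by rewrite !scaler0 addr0 scale1r -{1}(addr0 (T 0)) => /addrI.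
Qed.

Lemma linear_opZ (T : operator H) c x : linear_operator T -> dom T x ->
  dom T (c *: x) /\ T (c *: x) = c *: T x.
Proof.
move=> Tlin Tx; have := (Tlin.2 c x 0 Tx Tlin.1).
by rewrite !addr0 (linear_op0 Tlin) addr0.
Qed.

Lemma linear_opB (T : operator H) x y : linear_operator T -> dom T x ->
  dom T y -> dom T (x - y) /\ T (x - y) = T x - T y.
Proof.
move=> Tlin Tx Ty; have := Tlin.2 (-1) y x Ty Tx.
by rewrite !scaleN1r ![- _ + _]addrC.
Qed.

End RealNormComplete.

Section Hilbert.
Variables (R : realType) (H : completeNormedModType R[i]).
Variable dot : {dot H for conjC}.
Hypothesis dot_norm : forall x : H, dot x x = `|x| ^+ 2.

Let nrm (x : H) : R := rnorm x.

Definition rdot (x y : H) : R := complex.Re (dot x y).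

Lemma dotC x y : dot x y = (dot y x)^*%C.
Proof. by rewrite (hermC dot) expr0 mul1r. Qed.

Lemma rdot_inner : real_inner rdot.
Proof.
split=> [x y z|t x y|x y|x]; rewrite /rdot.
- by rewrite linearDl raddfD.
- by rewrite linearZl_LR /=; case: (dot x y) => u v /=; rewrite mul0r subr0.
- by rewrite dotC; case: (dot y x).
- by rewrite dot_norm rnormE -rmorphXn /= sqr_ge0.
Qed.

Lemma inorm_rdot x : inorm rdot x = nrm x.
Proof.
rewrite /inorm /rdot dot_norm rnormE -rmorphXn /= sqrtr_sqr ger0_norm//.
exact: rnorm_ge0.
Qed.

Lemma rdot_norm x : rdot x x = nrm x ^+ 2.
Proof. by rewrite -inorm_rdot (inorm2 rdot_inner). Qed.

Definition pair_dot (p q : H * H) : R := rdot p.1 q.1 + rdot p.2 q.2.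

Lemma pair_dot_inner : real_inner pair_dot.
Proof.
have [D Z C P] := rdot_inner; rewrite /pair_dot.
split=> [x y z|t x y|x y|x] /=.
- by rewrite !D addrACA.
- by rewrite !Z mulrDr.
- by rewrite C (C x.2).
- by rewrite addr_ge0.
Qed.

Lemma pair_inorm2 p : inorm pair_dot p ^+ 2 = nrm p.1 ^+ 2 + nrm p.2 ^+ 2.
Proof. by rewrite (inorm2 pair_dot_inner) /pair_dot !rdot_norm. Qed.

Lemma pair_inorm_lt p e : inorm pair_dot p < e -> nrm p.1 < e /\ nrm p.2 < e.
Proof.
move=> pe; have e0 := le_lt_trans (inorm_ge0 _ _) pe.
have := pair_inorm2 p; have : inorm pair_dot p ^+ 2 < e ^+ 2.
  by rewrite ltr_pXn2r ?nnegrE ?inorm_ge0// ltW.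
have n1 := rnorm_ge0 p.1; have n2 := rnorm_ge0 p.2.
move=> lt_e eq_e; split; rewrite -(@ltr_pXn2r _ 2) ?nnegrE ?(ltW e0)//.
  by apply: le_lt_trans lt_e; rewrite eq_e lerDl sqr_ge0.
by apply: le_lt_trans lt_e; rewrite eq_e lerDr sqr_ge0.
Qed.

Lemma pair_complete : complete_for (inorm pair_dot).
Proof.
move=> p pcauchy.
have [l1 l1P] : exists l, forall e, 0 < e -> exists N, forall k, (N <= k)%N ->
    nrm ((p k).1 - l) < e.
  apply: rnorm_complete => e /pcauchy[N NP].
  by exists N => j k Nj Nk; have [] := pair_inorm_lt (NP _ _ Nj Nk).
have [l2 l2P] : exists l, forall e, 0 < e -> exists N, forall k, (N <= k)%N ->
    nrm ((p k).2 - l) < e.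
  apply: rnorm_complete => e /pcauchy[N NP].
  by exists N => j k Nj Nk; have [] := pair_inorm_lt (NP _ _ Nj Nk).
exists (l1, l2) => e e0; have e2 : 0 < e / 2 by rewrite divr_gt0.
have [N1 N1P] := l1P _ e2; have [N2 N2P] := l2P _ e2.
exists (maxn N1 N2) => k; rewrite geq_max => /andP[/N1P lt1 /N2P lt2].
have := rnorm_ge0 ((p k).1 - l1); have := rnorm_ge0 ((p k).2 - l2).
rewrite -(@ltr_pXn2r _ 2) ?nnegrE ?inorm_ge0 ?(ltW e0)// pair_inorm2 /=.
by rewrite /nrm in lt1 lt2 *; nra.
Qed.

(** * Normal operators are hyponormal *)

Section Normal.
Variable T : operator H.
Hypothesis T_normal : normal_operator dot T.

Let T_lin : linear_operator T. Proof. by case: T_normal. Qed.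

Let adj := adjoint dot T.

(** The value of the adjoint is a choice among the admissible vectors; all that
    is used of it is that it is admissible. *)
Lemma adjointP x y : dom T x -> dom adj y -> dot (T x) y = dot x (adj y).
Proof.
move=> Tx [w wP].
exact: (@xgetPex _ 0 [set w | forall x, dom T x -> dot (T x) y = dot x w]
  (ex_intro _ w wP) x Tx).
Qed.

Definition dom_adjoint_comp : set H := [set x | dom T x /\ dom adj (T x)].

Lemma dom_adjoint_comp_adjoint x : dom_adjoint_comp x ->
  [/\ dom adj x, dom T (adj x) & T (adj x) = adj (T x)].
Proof.
case: T_normal => _ _ _ [domE TE] Dx.
have /TE /= E : dom (comp_operator T adj) x by rewrite domE.
have [] : dom (comp_operator T adj) x by rewrite domE.
by split.
Qed.

Lemma dom_adjoint_comp_lin c x y : dom_adjoint_comp x -> dom_adjoint_comp y ->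
  dom_adjoint_comp (c *: x + y).
Proof.
move=> [Tx [w1 w1P]] [Ty [w2 w2P]]; have [Txy TE] := T_lin.2 c x y Tx Ty.
split=> //; exists (c *: w1 + w2) => v Tv; rewrite TE.
by rewrite !linearDr /= !linearZr_LR /= w1P// w2P.
Qed.

(** Both squared norms are the pairing of [x] with T*T x = TT* x. *)
Lemma adjoint_norm x : dom_adjoint_comp x -> nrm (adj x) = nrm (T x).
Proof.
move=> Dx; have [ax Tax E] := dom_adjoint_comp_adjoint Dx; have [Tx aTx] := Dx.
apply/eqP; rewrite -(@eqrXn2 _ 2) ?rnorm_ge0// -!rdot_norm /rdot.
by rewrite -adjointP// E dotC -adjointP// (dotC (T x)); case: (dot _ _).
Qed.

(** Project [(u, T u)] onto the graph of the restriction of [T] to the domain of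
    T*T. The error [(x, T x)] is orthogonal to that graph. Projecting [(x, 0)]
    onto the whole graph of [T] yields [z] in the domain of T*T with
    z + T*T z = x, and testing the first orthogonality with [z] gives [x = 0]. *)
Lemma graph_core u e : dom T u -> 0 < e ->
  exists2 x, dom_adjoint_comp x & nrm (x - u) < e /\ nrm (T x - T u) < e.
Proof.
move=> Tu e0.
have proj (D : set H) p0 : D `<=` dom T -> D 0 ->
    (forall c x y, D x -> D y -> D (c *: x + y)) ->
    exists2 y, dom T y & (forall e, 0 < e -> exists2 x, D x &
      nrm (x - y) < e /\ nrm (T x - T y) < e) /\
      forall v, D v -> rdot v (y - p0.1) + rdot (T v) (T y - p0.2) = 0.
  move=> DT D0 Dlin; pose L := [set p : H * H | D p.1 /\ p.2 = T p.1].
  have [q Lq qorth] : exists2 q, approx_by (inorm pair_dot) L q &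
      forall v, L v -> pair_dot v (q - p0) = 0.
    apply: (orthogonal_projection pair_dot_inner _ pair_complete).
      by split; rewrite //= linear_op0.
    move=> t x y [Dx xE] [Dy yE]; split; first exact: Dlin.
    by rewrite /= xE yE (T_lin.2 t%:C _ _ (DT _ Dx) (DT _ Dy)).2.
  have [Tq q2] : dom T q.1 /\ q.2 = T q.1.
    case: T_normal => _ Tclosed _ _; apply: Tclosed => B /nbhs_ballP[/= r r0 rB].
    have Re0 : 0 < complex.Re r by move: r0; rewrite ltcE => /andP[].
    have [p [Dp pE] pq] := Lq _ Re0; have [p1 p2] := pair_inorm_lt pq.
    exists p; split; first by split => //; exact: DT.
    apply: rB; rewrite -(RRe_real (gtr0_real r0)).
    by split; rewrite -ball_normE /= rnormE ltcR rnormB.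
  exists q.1 => //; split=> [r /Lq[p [Dp pE] /pair_inorm_lt[p1 p2]]|v Dv].
    by exists p.1 => //; split=> //; rewrite -pE -q2.
  by rewrite -q2; apply: (qorth (v, T v)).
have D0 : dom_adjoint_comp 0.
  split; first exact: T_lin.1.
  by exists 0 => v _; rewrite (linear_op0 T_lin) !linear0r.
have [y Ty [yapp yorth]] := proj dom_adjoint_comp (u, T u) (fun x Dx => Dx.1) D0
  dom_adjoint_comp_lin.
pose x := y - u; have [Tx TxE] := linear_opB T_lin Ty Tu.
have xorth v : dom_adjoint_comp v -> rdot v x + rdot (T v) (T x) = 0.
  by move=> /yorth; rewrite TxE.
have [z Tz [_ zorth]] := proj (dom T) (x, 0) (fun x Tx => Tx) T_lin.1
  (fun c x y Tx Ty => (T_lin.2 c x y Tx Ty).1).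
have [Dr Zr Cr _] := rdot_inner.
have Dz : dom_adjoint_comp z.
  split=> //; exists (x - z) => v Tv.
  have re0 w : dom T w -> complex.Re (dot (T w) (T z) - dot w (x - z)) = 0.
    move=> /zorth /=; rewrite subr0 /rdot => E.
    by rewrite -[x - z]opprB linearNr opprK raddfD /= addrC.
  (* Real orthogonality to the complex subspace [dom T] is complex
     orthogonality: test also with i v. *)
  have [Tiv TivE] := linear_opZ 'i%C T_lin Tv.
  have := re0 _ Tiv; rewrite TivE !linearZl_LR /= -mulrBr.
  have := re0 _ Tv; set d := _ - _ => d1 d2; apply/eqP; rewrite -subr_eq0 -/d.
  move: d1 d2; case: d => r1 r2 /= ->; rewrite mul0r mul1r sub0r => /eqP.
  by rewrite oppr_eq0 => /eqP ->.
have x0 : x = 0.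
  apply: rnorm0_eq0; apply/eqP; rewrite -sqrf_eq0 -rdot_norm.
  have := xorth _ Dz; have := zorth _ Tx.
  rewrite /= subr0 (ipBr rdot_inner) (Cr z) (Cr (T z)) => h1 h2.
  by apply/eqP; move: h1 h2; lra.
have [v Dv vy] := yapp _ e0; exists v => //.
by have -> : u = y by apply/esym/eqP; rewrite -subr_eq0 -/x x0.
Qed.

(** On the domain of T*T this is the Cauchy-Schwarz inequality for
    <v, (T* - w) u>, since |(T* - w) u| = |(T - w) u| there; both sides are
    continuous in the graph norm, so it extends from the core. *)
Lemma hyponormal (w : R) v u : dom T v -> dom T u ->
  rdot (T v - w%:C *: v) u <= nrm v * nrm (T u - w%:C *: u).
Proof.
move=> Tv Tu; have ipi := rdot_inner.
have onD x : dom_adjoint_comp x ->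
    rdot (T v - w%:C *: v) x <= nrm v * nrm (T x - w%:C *: x).
  move=> Dx; have [ax Tax E] := dom_adjoint_comp_adjoint Dx; have [Tx aTx] := Dx.
  have adjx : rdot (adj x) x = rdot (T x) x.
    by rewrite (ipC ipi) [RHS]/rdot adjointP.
  have -> : nrm (T x - w%:C *: x) = nrm (adj x - w%:C *: x).
    apply/eqP; rewrite -(@eqrXn2 _ 2) ?rnorm_ge0// -!rdot_norm.
    rewrite !(ipBl ipi, ipBr ipi) !(ipZl ipi, ipZr ipi).
    by rewrite !(ipC ipi x) adjx !rdot_norm adjoint_norm.
  have -> : rdot (T v - w%:C *: v) x = rdot v (adj x - w%:C *: x).
    rewrite (ipBl ipi) (ipBr ipi) (ipZl ipi) (ipZr ipi).
    by rewrite {1}/rdot adjointP.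
  by rewrite -!inorm_rdot; exact: ip_CS.
have W0 : 0 <= nrm v * (1 + `|w|) + nrm (T v - w%:C *: v).
  by rewrite addr_ge0 ?mulr_ge0 ?rnorm_ge0 ?addr_ge0.
apply/ler_addgt0Pr => e e0.
pose d := e / (1 + (nrm v * (1 + `|w|) + nrm (T v - w%:C *: v))).
have d0 : 0 < d by rewrite divr_gt0//; lra.
have [x Dx [xu Txu]] := graph_core Tu d0.
have := onD _ Dx => le1.
have -> : rdot (T v - w%:C *: v) u = rdot (T v - w%:C *: v) x +
    rdot (T v - w%:C *: v) (u - x).
  by rewrite -(ipDr ipi) (addrC x) subrK.
have le2 : rdot (T v - w%:C *: v) (u - x) <= nrm (T v - w%:C *: v) * d.
  apply: (le_trans (ip_CS ipi _ _)); rewrite !inorm_rdot.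
  by apply: ler_wpM2l; rewrite ?rnorm_ge0// /nrm rnormB ltW.
have le3 : nrm (T x - w%:C *: x) <= nrm (T u - w%:C *: u) + (1 + `|w|) * d.
  have -> : T x - w%:C *: x =
      (T u - w%:C *: u) + ((T x - T u) - w%:C *: (x - u)).
    by rewrite scalerBr opprB addrA [X in _ = X + _]addrC !subrKA.
  apply: (le_trans (rnorm_triangle _ _)); apply: lerD => //.
  apply: (le_trans (rnorm_triangle _ _)); rewrite rnormN rnormZ_real.
  rewrite mulrDl mul1r; apply: lerD; first exact: ltW.
  by apply: ler_wpM2l => //; exact: ltW.
have nv := rnorm_ge0 v.
have le4 := ler_wpM2l nv le3.
have de : (1 + (nrm v * (1 + `|w|) + nrm (T v - w%:C *: v))) * d = e.
  by rewrite /d mulrC divfK// lt0r_neq0//; lra.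
rewrite -/(nrm v) -/(nrm (T u - w%:C *: u)) -/(nrm (T x - w%:C *: x)) in le4.
by rewrite -de; lra.
Qed.

(** Hyponormality applied to the vector [u = S v]. *)
Lemma normal_paranormal (w : R) v : let S x := T x - w%:C *: x in
  dom T v -> dom T (S v) -> nrm (S v) ^+ 2 <= nrm (S (S v)) * nrm v.
Proof.
move=> S Tv TSv; rewrite -rdot_norm mulrC; exact: hyponormal.
Qed.

End Normal.
End Hilbert.

(** * Contractions bounded away from the unit circle *)

Lemma bernoulli_ge (R : realDomainType) n (x : R) : 0 < x -> x <= 1 ->
  1 - n%:R * x <= (1 - x) ^+ n.
Proof.
move=> x0 x1; elim: n => [|n IH]; first by rewrite mul0r subr0 expr0.
have x1' : 0 <= 1 - x by rewrite subr_ge0.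
have := ler_wpM2l x1' IH; rewrite exprS; apply: le_trans.
rewrite -natr1 -subr_ge0.
rewrite (_ : _ - _ = n%:R * x ^+ 2); last by ring.
by rewrite mulr_ge0// sqr_ge0.
Qed.

Section Iterates.
Variables (R : realType) (H : completeNormedModType R[i]).
Variable dot : {dot H for conjC}.
Hypothesis dot_norm : forall x : H, dot x x = `|x| ^+ 2.
Variable U : H -> H.
Hypothesis U_lin : forall (c : R[i]) x y, U (c *: x + y) = c *: U x + U y.
Let nrm (x : H) : R := rnorm x.

Lemma iter_lin k (c : R[i]) x y :
  iter k U (c *: x + y) = c *: iter k U x + iter k U y.
Proof. by elim: k => //= k ->; rewrite U_lin. Qed.

Lemma rnorm_parallelogram (x y : H) :
  nrm (x + y) ^+ 2 + nrm (x - y) ^+ 2 = 2 * (nrm x ^+ 2 + nrm y ^+ 2).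
Proof. by rewrite /nrm -!(inorm_rdot dot_norm) (parallelogram (rdot_inner dot_norm)). Qed.

Lemma rnorm_unimodularZ (om : R[i]) (x : H) : `|om| = 1 -> nrm (om *: x) = nrm x.
Proof. by move=> om1; rewrite /nrm rnormZ om1 mul1r. Qed.

Lemma unimodular_sqrt (om : R[i]) : `|om| = 1 -> exists2 eta, `|eta| = 1 & om = eta * eta.
Proof.
move=> om1; exists (sqrtC om); last by rewrite -expr2 sqrtCK.
by apply/eqP; rewrite -(@eqrXn2 _ 2)// -normrX sqrtCK om1 expr1n.
Qed.

(** Write om = eta^2 and P = U^(2^k). The factorization
    P^2 - om = (P - eta) (P + eta) = (P + eta) (P - eta) and the bound for P at
    eta and - eta control the sums for (P + eta) y and (P - eta) y; by the
    parallelogram law these add up to twice the sum over the doubled range. *)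
Lemma iter_sub_unimodular_ge (c : R) : 0 <= c ->
  (forall om y, `|om| = 1 -> c * nrm y <= nrm (U y - om *: y)) ->
  forall k om y, `|om| = 1 ->
  c ^+ 2 * \sum_(j < 2 ^ k) nrm (iter j U y) ^+ 2
    <= nrm (iter (2 ^ k) U y - om *: y) ^+ 2.
Proof.
move=> c0 Uc; elim=> [|k IH] om y om1.
  rewrite expn0 big_ord1 /= -exprMn ler_pXn2r ?nnegrE ?mulr_ge0 ?rnorm_ge0//.
  exact: Uc.
have [eta eta1 ->] := unimodular_sqrt om1.
have etaN1 : `|- eta| = 1 by rewrite normrN.
pose P := iter (2 ^ k) U.
have Plin : forall (a : R[i]) x z, P (a *: x + z) = a *: P x + P z by exact: iter_lin.
have dbl : iter (2 ^ k.+1) U y = P (P y) by rewrite expnS mul2n -addnn iterD.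
have fm : iter (2 ^ k.+1) U y - (eta * eta) *: y =
    P (eta *: y + P y) - eta *: (eta *: y + P y).
  by rewrite dbl Plin scalerDr scalerA opprD [- (_ *: y) - _]addrC addrA
      (addrC (_ *: P y)) addrK.
have fp : iter (2 ^ k.+1) U y - (eta * eta) *: y =
    P (- eta *: y + P y) - (- eta) *: (- eta *: y + P y).
  rewrite dbl Plin scalerDr scalerA mulrNN opprD [- (_ *: y) - _]addrC addrA.
  by rewrite (addrC (_ *: P y)) addrK.
have le1 := IH eta (eta *: y + P y) eta1.
have le2 := IH (- eta) (- eta *: y + P y) etaN1.
rewrite -/P -fm in le1; rewrite -/P -fp in le2.
have sum_split : \sum_(j < 2 ^ k) nrm (iter j U (eta *: y + P y)) ^+ 2 +
    \sum_(j < 2 ^ k) nrm (iter j U (- eta *: y + P y)) ^+ 2 =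
    2 * \sum_(j < 2 ^ k.+1) nrm (iter j U y) ^+ 2.
  rewrite -big_split /= expnS mul2n -addnn big_split_ord /= mulrDr.
  rewrite !mulr_sumr -big_split /=; apply: eq_bigr => j _.
  rewrite !iter_lin scaleNr (addrC (eta *: _)) (addrC (- _)).
  rewrite rnorm_parallelogram rnorm_unimodularZ// mulrDr addrC.
  by rewrite /P -iterD addnC.
have := lerD le1 le2; rewrite -mulrDr sum_split.
by rewrite mulrCA -mulr2n -[leRHS]mulr_natl ler_pM2l.
Qed.

(** The ratios of successive norms |U^(j+1) y| / |U^j y| are nondecreasing, so
    each is at least the first one. *)
Lemma paranormal_iter :
  (forall y, nrm (U y) ^+ 2 <= nrm (U (U y)) * nrm y) ->
  forall k y, nrm (U y) ^+ k.+1 <= nrm (iter k.+1 U y) * nrm y ^+ k.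
Proof.
move=> Upara; elim=> [|k IH] y; first by rewrite expr0 expr1 mulr1.
have n0 x : 0 <= nrm x by exact: rnorm_ge0.
have := n0 (U y); rewrite le_eqVlt => /predU1P[U0|U0].
  by rewrite -U0 expr0n /= mulr_ge0// exprn_ge0.
rewrite -(@ler_pM2r _ (nrm (U y) ^+ k)) ?exprn_gt0//.
have -> : nrm (U y) ^+ k.+2 * nrm (U y) ^+ k = (nrm (U y) ^+ 2) ^+ k.+1.
  by rewrite -exprM -exprD; congr (_ ^+ _); rewrite addSnnS addnn mul2n.
apply: (@le_trans _ _ ((nrm (U (U y)) * nrm y) ^+ k.+1)).
  by rewrite ler_pXn2r ?nnegrE ?mulr_ge0 ?exprn_ge0.
rewrite exprMn mulrAC ler_wpM2r ?exprn_ge0//.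
by have := IH (U y); rewrite -iterSr.
Qed.

Lemma contraction_iter k y : (forall y, nrm (U y) <= nrm y) ->
  nrm (iter k U y) <= nrm y.
Proof. by move=> Uc; elim: k => //= k; apply: le_trans; exact: Uc. Qed.

(** For n = 2^k large, the bound on U^n - 1 forces |U^n y| <= |y| / 2, hence
    |U y| <= 2^(-1/n) |y|. The root 2^(-1/n) is replaced by 1 - 1/(2n), which
    dominates it by Bernoulli's inequality. *)
Lemma contraction_improve (c : R) : 0 < c ->
  (forall y, nrm (U y) <= nrm y) ->
  (forall y, nrm (U y) ^+ 2 <= nrm (U (U y)) * nrm y) ->
  (forall om y, `|om| = 1 -> c * nrm y <= nrm (U y - om *: y)) ->
  exists2 theta, 0 <= theta < 1 & forall y, nrm (U y) <= theta * nrm y.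
Proof.
move=> c0 Uc Upara Usub; have n0 x : 0 <= nrm x by exact: rnorm_ge0.
(* c^2 n |U^n y|^2 <= |U^n y - y|^2 <= 4 |y|^2, so 16 yields |U^n y| <= |y| / 2. *)
have [k kP] : exists k, 16 <= c ^+ 2 * (2 ^ k)%:R.
  have c2 : 0 <= 16 / c ^+ 2 by rewrite divr_ge0// exprn_ge0// ltW.
  have := archi_boundP c2; set k := Num.bound _ => kP.
  exists k; rewrite mulrC -ler_pdivrMr ?exprn_gt0//.
  by apply: ltW; apply: lt_trans kP _; rewrite ltr_nat ltn_expl.
pose n := (2 ^ k)%N; have n_gt0 : (0 < n)%N by rewrite expn_gt0.
have half y : nrm (iter n U y) <= nrm y / 2.
  rewrite -(@ler_pXn2r _ 2) ?nnegrE ?divr_ge0//.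
  have one1 : `|1 : R[i]| = 1 by rewrite normr1.
  have := iter_sub_unimodular_ge (ltW c0) Usub k y one1; rewrite -/n scale1r.
  have : nrm (iter n U y - y) ^+ 2 <= 4 * nrm y ^+ 2.
    have -> : 4 * nrm y ^+ 2 = (2 * nrm y) ^+ 2 by ring.
    rewrite ler_pXn2r ?nnegrE ?mulr_ge0//.
    apply: (le_trans (rnorm_triangle _ _)); rewrite rnormN.
    by have := contraction_iter n y Uc; rewrite /nrm; lra.
  have : n%:R * nrm (iter n U y) ^+ 2 <= \sum_(j < n) nrm (iter j U y) ^+ 2.
    rewrite mulr_natl -[n in _ *+ n]card_ord -sumr_const; apply: ler_sum => j _.
    rewrite ler_pXn2r ?nnegrE//.
    have {1}-> : n = (n - j + j)%N by rewrite subnK// ltnW.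
    by rewrite iterD; exact: contraction_iter.
  move=> h1 h2 h3.
  have h4 := ler_wpM2l (sqr_ge0 c) h1.
  have h5 := ler_wpM2r (sqr_ge0 (nrm (iter n U y))) kP.
  rewrite -/n in h5; rewrite expr_div_n; nra.
pose theta : R := 1 - (2 * n%:R)^-1.
have N0 : 1 <= n%:R :> R by rewrite ler1n.
have i0 : 0 < (2 * n%:R : R)^-1 by rewrite invr_gt0; lra.
have i1 : (2 * n%:R : R)^-1 <= 1 by rewrite invf_le1; lra.
have th : 0 <= theta < 1 by rewrite /theta; apply/andP; split; lra.
exists theta => // y; have /andP[th0 th1] := th.
have bern : 2^-1 <= theta ^+ n.
  apply: le_trans (bernoulli_ge n i0 i1).
  by rewrite invfM mulrCA divff ?mulr1 ?lt0r_neq0//; lra.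
have := paranormal_iter Upara n.-1 y; rewrite prednK// => le1.
rewrite -(@ler_pXn2r _ n) ?nnegrE ?mulr_ge0// exprMn.
apply: (le_trans le1).
apply: (le_trans (ler_wpM2r (exprn_ge0 _ (n0 y)) (half y))).
rewrite mulrAC -exprS prednK// mulrC.
by rewrite ler_wpM2r// exprn_ge0.
Qed.

End Iterates.

(** * Distance of a point to the spectrum of a normal operator *)

Lemma Re_norm_le (R : realType) (z : R[i]) :
  complex.Re `|z| <= `|complex.Re z| + `|complex.Im z|.
Proof.
rewrite normc_def /= -(@ler_pXn2r _ 2) ?nnegrE ?sqrtr_ge0 ?addr_ge0//.
rewrite sqr_sqrtr ?addr_ge0 ?sqr_ge0// sqrrD !real_normK ?num_real//.
by rewrite lerD2r lerDl mulrn_wge0// mulr_ge0.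
Qed.

Lemma Re_Im_le_norm (R : realType) (z : R[i]) :
  `|complex.Re z| <= complex.Re `|z| /\ `|complex.Im z| <= complex.Re `|z|.
Proof.
by rewrite normc_def /= -!sqrtr_sqr !ler_wsqrtr ?lerDl ?lerDr ?sqr_ge0.
Qed.

Section Resolvent.
Variables (R : realType) (H : completeNormedModType R[i]).
Let nrm (x : H) : R := rnorm x.
Implicit Types (T A : operator H) (z : R[i]).

Lemma resolvent_bounded_below T z : resolvent_set T z ->
  exists2 M, 0 < M & forall u, dom T u -> nrm u <= M * nrm (T u - z *: u).
Proof.
move=> [V [_ _ VK [M0 VM]]]; exists (`|M0| + 1); first by rewrite ltr_wpDl.
move=> u Tu; rewrite -{1}(VK u Tu).
have := VM (T u - z *: u); rewrite !rnormE -rmorphM lecR => /le_trans; apply.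
by apply: ler_wpM2r; [exact: rnorm_ge0|have := ler_norm M0; lra].
Qed.

Lemma resolvent_inverse_lin T z (V : H -> H) : linear_operator T ->
  (forall y, dom T (V y)) -> (forall y, T (V y) - z *: V y = y) ->
  (forall x, dom T x -> V (T x - z *: x) = x) ->
  forall (c : R[i]) x y, V (c *: x + y) = c *: V x + V y.
Proof.
move=> Tlin TV VK KV c x y.
have [Tc TcE] := Tlin.2 c _ _ (TV x) (TV y).
rewrite -[RHS]KV// TcE; congr V.
rewrite -{1}(VK x) -{1}(VK y) scalerBr scalerDr !scalerA (mulrC c).
by rewrite opprD addrACA.
Qed.

(** Squares rather than discs, because they are products of compact real
    intervals; the disc of radius [rho] is contained in the square. *)
Definition square (w rho : R) : set R[i] :=
  [set z | `|complex.Re z - w| <= rho /\ `|complex.Im z| <= rho].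

(** A lower bound for [T - z] persists, with half its value, near [z]; compactness
    of the square makes it uniform. *)
Lemma uniformly_bounded_below T w rho : square w rho `<=` resolvent_set T ->
  exists2 c, 0 < c &
    forall z u, square w rho z -> dom T u -> c * nrm u <= nrm (T u - z *: u).
Proof.
move=> sqT.
pose K : set (R * R) := `[w - rho, w + rho] `*` `[- rho, rho].
have cK : compact K by apply: compact_setX; exact: segment_compact.
pose P (c : R) (p : R * R) :=
  forall u, dom T u -> c * nrm u <= nrm (T u - (p.1 +i* p.2) *: u).
have KP : \forall c \near 0^'+, K `<=` P c.
  apply: (proj1 (compact_near_coveringP K) cK) => p [/= p1 p2].
  have [M M0 TM] : exists2 M, 0 < M & forall u, dom T u ->
      nrm u <= M * nrm (T u - (p.1 +i* p.2) *: u).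
    apply: resolvent_bounded_below; apply: sqT; split => /=.
      by move: p1; rewrite in_itv /= ler_distl.
    by move: p2; rewrite in_itv /= ler_norml.
  have d0 : 0 < (4 * M)^-1 by rewrite invr_gt0; lra.
  near=> p' c => u Tu.
  have [p'1 p'2] : `|p.1 - p'.1| < (4 * M)^-1 /\ `|p.2 - p'.2| < (4 * M)^-1.
    near: p'; exists (ball p.1 (4 * M)^-1, ball p.2 (4 * M)^-1).
      by split; exact: nbhsx_ballx.
    by move=> p' [].
  have cM : c <= (2 * M)^-1.
    by near: c; apply: nbhs_right_le; rewrite invr_gt0; lra.
  set z := p.1 +i* p.2 in TM; set z' := p'.1 +i* p'.2.
  have -> : T u - z' *: u = (T u - z *: u) - (z' - z) *: u.
    by rewrite scalerBl opprB addrA subrK.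
  have n0 : 0 <= nrm u by exact: rnorm_ge0.
  have zz : complex.Re `|z' - z| <= (2 * M)^-1.
    apply: (le_trans (Re_norm_le _)); rewrite /= distrC (distrC p'.2).
    have -> : (2 * M)^-1 = (4 * M)^-1 + (4 * M)^-1 by field; rewrite lt0r_neq0.
    by rewrite lerD// ltW.
  have := rnorm_triangleB (T u - z *: u) ((z' - z) *: u).
  rewrite rnormZ -/(nrm _) -/(nrm u) -/(nrm (_ - _)) => h1.
  have h2 := ler_wpM2r n0 zz; have h3 := ler_wpM2r n0 cM.
  have h4 : M^-1 * nrm u <= nrm (T u - z *: u) by rewrite ler_pdivrMl// TM.
  have h5 : M^-1 * nrm u = (2 * M)^-1 * nrm u + (2 * M)^-1 * nrm u.
    by field; rewrite lt0r_neq0.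
  by rewrite /= /nrm in h1 h2 h3 h4 h5 *; lra.
have [c [c0 cP]] : exists c, 0 < c /\ K `<=` P c.
  near ((0:R)^'+) => c; exists c; split; last by near: c.
  by near: c; exact: nbhs_right_gt.
exists c => // -[x y] u [/= zx zy] Tu; apply: (cP (x, y)) => //; split=> /=.
  by rewrite in_itv /= -ler_distl.
by rewrite in_itv /= -ler_norml.
Unshelve. all: by end_near.
Qed.

End Resolvent.

Section SpectralDistance.
Variables (R : realType) (H : completeNormedModType R[i]).
Variable dot : {dot H for conjC}.
Hypothesis dot_norm : forall x : H, dot x x = `|x| ^+ 2.
Variable T : operator H.
Hypothesis T_normal : normal_operator dot T.
Let nrm (x : H) : R := rnorm x.

(** [nu] is the norm of the inverse [V] of [T - w]. If [nu * rho] exceeded [1],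
    the points [w + la] with |la| = 1 / nu would be resolvent points in the
    square, so the contraction [U] = V / nu would be bounded away from the unit
    circle and [contraction_improve] would give a norm smaller than [nu]. *)
Lemma normal_bounded_below_square (w rho : R) : 0 < rho ->
  square w rho `<=` resolvent_set T ->
  forall u, dom T u -> rho * nrm u <= nrm (T u - w%:C *: u).
Proof.
move=> rho0 sqT; have Tlin : linear_operator T by case: T_normal.
have [c c0 cP] := uniformly_bounded_below sqT.
have n0 (x : H) : 0 <= nrm x by exact: rnorm_ge0.
have [V [TV VK KV [M VM]]] : resolvent_set T w%:C.
  by apply: sqT; split; rewrite /= ?subrr normr0 ltW.
have Vlin := resolvent_inverse_lin Tlin TV VK KV.
pose E := [set k : R | 0 <= k /\ forall y, nrm (V y) <= k * nrm y].
have E0 : has_inf E.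
  split; last by exists 0 => k [].
  exists `|M|; split=> // y.
  have := VM y; rewrite !rnormE -rmorphM lecR => /le_trans; apply.
  by apply: ler_wpM2r; [exact: n0|exact: ler_norm].
pose nu := inf E.
have nu0 : 0 <= nu by apply: lb_le_inf; [case: E0|move=> k []].
have nuV y : nrm (V y) <= nu * nrm y.
  apply/ler_addgt0Pr => e e0.
  have d0 : 0 < e / (1 + nrm y) by rewrite divr_gt0//; have := n0 y; lra.
  have [k [k0 kV] kd] := inf_adherent d0 E0.
  apply: (le_trans (kV y)).
  apply: (@le_trans _ _ ((nu + e / (1 + nrm y)) * nrm y)).
    by apply: ler_wpM2r => //; exact: ltW.
  rewrite mulrDl lerD2l mulrAC ler_pdivrMr; last by have := n0 y; lra.
  by rewrite ler_pM2l// lerDr.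
suff nurho : nu * rho <= 1.
  move=> u Tu; rewrite -{1}(KV u Tu); set y := T u - _.
  apply: (le_trans (ler_wpM2l (ltW rho0) (nuV y))).
  by rewrite mulrA (mulrC rho) ler_piMl.
rewrite leNgt; apply/negP => nurho.
have nu_gt0 : 0 < nu by rewrite -(pmulr_lgt0 _ rho0); exact: lt_trans nurho.
have nuI : 0 <= nu^-1 by rewrite invr_ge0.
pose U y := (nu^-1)%:C *: V y.
have Ulin (a : R[i]) x y : U (a *: x + y) = a *: U x + U y.
  by rewrite /U Vlin scalerDr !scalerA (mulrC _%:C).
have UE y : nrm (U y) = nu^-1 * nrm (V y).
  by rewrite /nrm rnormZ_real ger0_norm.
have Uc y : nrm (U y) <= nrm y by rewrite UE mulrC ler_pdivrMr// mulrC.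
have Upara y : nrm (U y) ^+ 2 <= nrm (U (U y)) * nrm y.
  have -> : U (U y) = (nu^-1 * nu^-1)%:C *: V (V y).
    have VZ (a : R[i]) x : V (a *: x) = a *: V x.
      have V0 : V 0 = 0.
        by have := Vlin (-1) 0 0; rewrite scaler0 addr0 scaleN1r addNr.
      by have := Vlin a x 0; rewrite V0 !addr0.
    by rewrite /U VZ scalerA -rmorphM.
  rewrite UE /nrm rnormZ_real ger0_norm ?mulr_ge0// exprMn (expr2 nu^-1) -mulrA.
  rewrite -[leRHS]mulrA -[leRHS]mulrA; do 2!apply: ler_wpM2l => //.
  have := normal_paranormal dot_norm T_normal (w := w) (v := V (V y)).
  by rewrite /= !VK mulrC; apply; exact: TV.
(* For u = V y the bound [c] controls |u| by |y - la u|, and then |y| is at most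
   |y - la u| + rho |u|: this turns [c] into [c / (c + rho)]. *)
have Usub om y : `|om| = 1 -> c / (c + rho) * nrm y <= nrm (U y - om *: y).
  move=> om1; pose u := V y; pose la := (nu^-1)%:C * om^-1.
  have om0 : om != 0 by rewrite -normr_eq0 om1 oner_neq0.
  have lanu : complex.Re `|la| = nu^-1.
    rewrite normrM normfV om1 invr1 mulr1 normc_def /= expr0n addr0 sqrtr_sqr.
    by rewrite ger0_norm.
  have nui : nu^-1 <= rho.
    by rewrite -[leLHS]mulr1 ler_pdivrMl// ltW.
  have yE : y = T u - w%:C *: u by rewrite VK.
  have lasq : square w rho (w%:C + la).
    have [] := Re_Im_le_norm la; rewrite lanu => h1 h2.
    split; rewrite raddfD /= ?add0r; last exact: le_trans nui.
    by rewrite addrC addKr; exact: le_trans nui.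
  have := cP _ _ lasq (TV y); rewrite -/u.
  rewrite scalerDl opprD addrA -yE => h1.
  have -> : nrm (U y - om *: y) = nrm (y - la *: u).
    have -> : U y - om *: y = - om *: (y - la *: u).
      rewrite scalerBr /U -/u scalerA /la mulNr mulrCA divff// mulr1 scaleNr.
      by rewrite scaleNr opprK addrC.
    by rewrite /nrm rnorm_unimodularZ// normrN.
  have cr : 0 < c + rho by rewrite addr_gt0.
  rewrite mulrAC ler_pdivrMr//.
  have h2 : nrm y <= nrm (y - la *: u) + rho * nrm u.
    rewrite -{1}(subrK (la *: u) y); apply: (le_trans (rnorm_triangle _ _)).
    by rewrite lerD2l rnormZ lanu ler_wpM2r// rnorm_ge0.
  have := n0 u; rewrite /nrm in h1 h2 *; nra.
have cr0 : 0 < c / (c + rho) by rewrite divr_gt0// addr_gt0.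
have [theta /andP[th0 th1] thP] :=
  contraction_improve dot_norm Ulin cr0 Uc Upara Usub.
have : nu <= theta * nu.
  apply: ge_inf; first by case: E0.
  split=> [|y]; first by rewrite mulr_ge0.
  have : nrm (U y) <= theta * nrm y := thP y.
  by rewrite UE ler_pdivrMl// mulrA (mulrC nu).
by rewrite leNgt gtr_pMl// th1.
Qed.

Lemma normal_bounded_below (w r : R) : 0 < r ->
  strip (w - r) (w + r) `<=` resolvent_set T ->
  forall u, dom T u -> r * nrm u <= nrm (T u - w%:C *: u).
Proof.
move=> r0 rT u Tu; apply/ler_addgt0Pr => e e0.
have n0 : 0 <= nrm u by exact: rnorm_ge0.
pose d := minr (r / 2) (e / (1 + nrm u)).
have d0 : 0 < d by rewrite lt_min !divr_gt0//; lra.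
have dr : d <= r / 2 by rewrite ge_min lexx.
have de : d * (1 + nrm u) <= e.
  by rewrite -ler_pdivlMr ?ge_min ?lexx ?orbT//; lra.
have rd0 : 0 < r - d by lra.
have := normal_bounded_below_square rd0 _ Tu; have : square w (r - d) `<=` resolvent_set T.
  move=> z [zx _]; apply: rT; move: zx; rewrite /strip /= ler_distl.
  by move=> /andP[? ?]; apply/andP; split; lra.
by move=> sq /(_ w sq); lra.
Qed.

End SpectralDistance.

(** * Relatively bounded perturbations *)

Section Perturbation.
Variables (R : realType) (H : completeNormedModType R[i]).
Let nrm (x : H) : R := rnorm x.
Implicit Types (T A : operator H) (z : R[i]).

Lemma contraction_fixpoint (f : H -> H) (k : R) : 0 <= k < 1 ->
  (forall x y, nrm (f x - f y) <= k * nrm (x - y)) -> exists x, f x = x.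
Proof.
move=> /andP[k0 k1] fk; have n0 (x : H) : 0 <= nrm x by exact: rnorm_ge0.
pose p n := iter n f 0.
have pdist n x y : nrm (iter n f x - iter n f y) <= k ^+ n * nrm (x - y).
  elim: n => [|n IH]; first by rewrite expr0 mul1r.
  apply: (le_trans (fk _ _)); rewrite exprS -mulrA.
  exact: ler_wpM2l IH.
pose C := nrm (p 1 - p 0) / (1 - k).
have k1' : 0 < 1 - k by rewrite subr_gt0.
have C0 : 0 <= C by rewrite divr_ge0// ltW.
have pC m : nrm (p m - p 0) <= C.
  elim: m => [|m IH]; first by rewrite subrr /nrm rnorm0.
  have -> : p m.+1 - p 0 = (p m.+1 - p 1) + (p 1 - p 0) by rewrite subrKA.
  apply: (le_trans (rnorm_triangle _ _)).
  have CE : nrm (p 1 - p 0) = C * (1 - k) by rewrite /C divfK// lt0r_neq0.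
  have := fk (p m) (p 0); have := ler_wpM2l k0 IH.
  by rewrite -/(nrm (p 1 - p 0)) CE /nrm /p /=; lra.
have pcauchy n m : (n <= m)%N -> nrm (p m - p n) <= k ^+ n * C.
  move=> nm; rewrite /p -(subnKC nm) iterD -[X in _ - X]/(iter n f (p 0)).
  apply: (le_trans (pdist _ _ _)); apply: ler_wpM2l; first exact: exprn_ge0.
  exact: pC.
have small e : 0 < e -> exists N, forall n, (N <= n)%N -> k ^+ n * C < e.
  move=> e0; have d0 : 0 < e / (C + 1) by rewrite divr_gt0//; lra.
  have /cvgrPdist_lt/(_ _ d0)[N _ NP] : (fun n => k ^+ n) @ \oo --> (0 : R).
    by apply: cvg_expr; rewrite ger0_norm.
  exists N => n Nn; have := NP n Nn; rewrite /= sub0r normrN ger0_norm ?exprn_ge0//.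
  rewrite ltr_pdivlMr; last lra.
  by have := exprn_ge0 n k0; lra.
have [l lP] : exists l, forall e, 0 < e -> exists N, forall n, (N <= n)%N ->
    nrm (p n - l) < e.
  apply: rnorm_complete => e /small[N NP]; exists N => i j Ni Nj.
  have [ij|ji] := leqP i j.
    by rewrite rnormB; apply: le_lt_trans (pcauchy _ _ ij) (NP _ Ni).
  by apply: le_lt_trans (pcauchy _ _ (ltnW ji)) (NP _ Nj).
exists l; apply/eqP; rewrite -subr_eq0; apply/eqP/rnorm0_eq0/eqP.
rewrite eq_le n0 andbT; apply/ler_addgt0Pr => e e0; rewrite add0r.
have e2 : 0 < e / 2 by rewrite divr_gt0.
have [N NP] := lP _ e2.
have -> : f l - l = (f l - p N.+1) + (p N.+1 - l) by rewrite subrKA.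
apply: (le_trans (rnorm_triangle _ _)).
have h1 : nrm (f l - p N.+1) <= k * nrm (p N - l).
  by rewrite [nrm (p N - l)]rnormB; exact: fk.
have h2 := NP N (leqnn N); have h3 := NP N.+1 (leqnSn N).
have h4 : k * nrm (p N - l) <= nrm (p N - l) by rewrite ler_piMl// ltW.
by rewrite /nrm in h1 h2 h3 h4 *; lra.
Qed.

(** With [B u = A u - (z - z0) u] and [V] the inverse of [T - z0], the operator
    T + A - z equals (1 + B V) (T - z0), and [1 + B V] is inverted by solving
    [y = h - B (V y)], a contraction with constant [k]. *)
Lemma resolvent_perturbation T A z0 z (k : R) :
  linear_operator T -> linear_operator A -> dom T `<=` dom A ->
  resolvent_set T z0 -> 0 <= k < 1 ->
  (forall u, dom T u ->
     nrm (A u - (z - z0) *: u) <= k * nrm (T u - z0 *: u)) ->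
  resolvent_set (add_operator T A) z.
Proof.
move=> Tlin Alin TA Tz0 k01 Bk; have /andP[k0 k1] := k01.
have [M M0 TM] := resolvent_bounded_below Tz0.
have [V [TV VK KV _]] := Tz0.
have Vlin := resolvent_inverse_lin Tlin TV VK KV.
pose B u := A u - (z - z0) *: u.
have VB x y : V (x - y) = V x - V y.
  by have := Vlin (-1) y x; rewrite !scaleN1r ![- _ + _]addrC.
have BB u v : dom T u -> dom T v -> B (u - v) = B u - B v.
  move=> Tu Tv; rewrite /B (linear_opB Alin (TA _ Tu) (TA _ Tv)).2.
  by rewrite scalerBr !opprD !opprK addrACA.
have splitz u : T u + A u - z *: u = (T u - z0 *: u) + B u.
  rewrite /B scalerBl opprB addrACA; congr (_ + _).
  by rewrite addKr.
have /choice[g gP] (h : H) : exists y, h - B (V y) = y.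
  apply: (@contraction_fixpoint _ k) => // x y.
  have -> : h - B (V x) - (h - B (V y)) = - B (V (x - y)).
    by rewrite VB BB// !opprB [LHS]addrC subrKA.
  rewrite /nrm rnormN -/(nrm _); apply: (le_trans (Bk _ (TV _))).
  by rewrite VK.
have lower u : dom T u ->
    (1 - k) * nrm (T u - z0 *: u) <= nrm (T u + A u - z *: u).
  move=> Tu; have := Bk _ Tu; rewrite splitz -/(B u).
  have := rnorm_triangleB (T u - z0 *: u) (- B u); rewrite rnormN opprK.
  by rewrite /nrm; lra.
have k1' : 0 < 1 - k by rewrite subr_gt0.
have gE h : T (V (g h)) + A (V (g h)) - z *: V (g h) = h.
  by rewrite splitz VK -{1}gP subrK.
exists (V \o g); split=> [y|y|x /= Tx|] /=.
- exact: TV.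
- exact: gE.
- set y := T x + A x - z *: x; set x' := V (g y).
  have Tx' : dom T x' by exact: TV.
  have [Td TdE] := linear_opB Tlin Tx' Tx.
  have := lower _ Td; rewrite splitz BB// TdE scalerBr.
  have -> : T x' - T x - (z0 *: x' - z0 *: x) + (B x' - B x) =
      (T x' + A x' - z *: x') - (T x + A x - z *: x).
    rewrite !splitz (opprD (T x - _)) [RHS]addrACA; congr (_ + _).
    by rewrite !opprD !opprK addrACA.
  rewrite gE subrr /nrm rnorm0 pmulr_rle0// => d0.
  have dE : T x' - T x - (z0 *: x' - z0 *: x) = T (x' - x) - z0 *: (x' - x).
    by rewrite TdE scalerBr.
  have := TM _ Td; rewrite -dE.
  have -> : rnorm (T x' - T x - (z0 *: x' - z0 *: x)) = 0.
    by apply/eqP; rewrite eq_le d0 rnorm_ge0.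
  rewrite mulr0 => d1; apply/eqP; rewrite -subr_eq0; apply/eqP/rnorm0_eq0/eqP.
  by rewrite eq_le d1 rnorm_ge0.
- exists (M / (1 - k)) => h; rewrite !rnormE -rmorphM lecR.
  apply: (le_trans (TM _ (TV _))); rewrite -mulrA (ler_wpM2l (ltW M0))//.
  rewrite ler_pdivlMl//.
  by have := lower _ (TV (g h)); rewrite gE.
Qed.

End Perturbation.

(** * Survival of a single gap *)

Section Gap.
Variables (R : realType) (H : completeNormedModType R[i]).
Variable dot : {dot H for conjC}.
Hypothesis dot_norm : forall x : H, dot x x = `|x| ^+ 2.
Let nrm (x : H) : R := rnorm x.

(** Completing the square around the midpoint [w]: the shift [(1 - B) * w] is the
    one for which the mixed terms in <x, y> cancel. *)
Lemma rnorm_shift_identity (x y : H) (w B : R) :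
  nrm (x - ((1 - B) * w)%:C *: y) ^+ 2 = B * nrm x ^+ 2 +
    (1 - B) * (nrm (x - w%:C *: y) ^+ 2 - B * w ^+ 2 * nrm y ^+ 2).
Proof.
have ipi := rdot_inner dot_norm; rewrite /nrm -!(rdot_norm dot_norm).
rewrite !(ipBl ipi, ipBr ipi) !(ipZl ipi, ipZr ipi) (ipC ipi y x).
ring.
Qed.

(** For [kap = 1] this is the hypothesis, weakened by w^2 <= be^2. All terms
    depend continuously on [kap], so it remains true slightly above [1]; there
    [b ^+ 2 < 1 / 5] more than ensures [kap * b ^+ 2 < 1] for [kap <= 2]. *)
Lemma gap_margin (a b w r be : R) :
  0 <= w <= be -> 5 * b ^+ 2 < 1 ->
  a ^+ 2 + b ^+ 2 * be ^+ 2 < (1 - b ^+ 2) * r ^+ 2 ->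
  exists2 kap, 1 < kap & kap * b ^+ 2 < 1 /\
    kap * a ^+ 2 < (1 - kap * b ^+ 2) * (r ^+ 2 - kap * b ^+ 2 * w ^+ 2).
Proof.
move=> /andP[w0 wbe] b5 abr.
have b0 := sqr_ge0 b; have a0 := sqr_ge0 a; have r0 := sqr_ge0 r.
have w2be : w ^+ 2 <= be ^+ 2 by rewrite ler_pXn2r ?nnegrE//; lra.
have W0 := sqr_ge0 w.
set b2 := b ^+ 2 in b5 abr b0 *; set a2 := a ^+ 2 in abr a0 *.
set r2 := r ^+ 2 in abr r0 *; set w2 := w ^+ 2 in w2be W0 *.
set be2 := be ^+ 2 in abr w2be *.
pose f := (1 - b2) * (r2 - b2 * w2) - a2.
pose K := b2 * r2 + b2 * w2 + a2.
have K0 : 0 <= K by rewrite /K !addr_ge0// mulr_ge0.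
have f0 : 0 < f by rewrite /f; nra.
have K1 : 0 < 2 * (K + 1) by lra.
pose eta := minr 1 (f / (2 * (K + 1))).
have eta0 : 0 < eta by rewrite lt_min ltr01 divr_gt0.
have eta1 : eta <= 1 by rewrite ge_min lexx.
have etaK : eta * (2 * (K + 1)) <= f.
  by rewrite -ler_pdivlMr// ge_min lexx orbT.
exists (1 + eta); first by rewrite ltrDl.
have : 0 < f - eta * K by nra.
split; first by nra.
have E : (1 - (1 + eta) * b2) * (r2 - (1 + eta) * b2 * w2) - (1 + eta) * a2
  = f - eta * K + (2 * eta + eta ^+ 2) * (b2 ^+ 2 * w2) by rewrite /f /K; ring.
rewrite -subr_gt0 E ltr_wpDr//.
apply: mulr_ge0; last by apply: mulr_ge0 => //; exact: sqr_ge0.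
by have := sqr_ge0 eta; lra.
Qed.

(** The rectangle is centred at [x0], where A is bounded relative to T - x0 with
    constant [k0 = kap^(-1/2)]. Moving to a point [z] at distance at most
    [2 * e] adds at most [2 * e * M] to that constant, [M] being a bound for the
    inverse of T - x0. *)
Lemma gap_survives_perturbation (T A : operator H) (a b al be : R) :
  normal_operator dot T -> linear_operator A -> dom T `<=` dom A ->
  5 * b ^+ 2 < 1 ->
  (forall x : H, dom T x ->
     nrm (A x) ^+ 2 <= a ^+ 2 * nrm x ^+ 2 + b ^+ 2 * nrm (T x) ^+ 2) ->
  0 <= al -> al < be -> strip al be `<=` resolvent_set T ->
  gap_quotient a b al be < 1 -> gap_survives (add_operator T A) al be.
Proof.
move=> T_normal Alin TA b5 Abound al0 albe gap q1.
have Tlin : linear_operator T by case: T_normal.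
have n0 (x : H) : 0 <= nrm x by exact: rnorm_ge0.
pose w := (al + be) / 2; pose r := (be - al) / 2.
have r0 : 0 < r by rewrite /r; lra.
have wr1 : w - r = al by rewrite /w /r; field.
have wr2 : w + r = be by rewrite /w /r; field.
have w0 : 0 <= w <= be by apply/andP; split; lra.
have abr : a ^+ 2 + b ^+ 2 * be ^+ 2 < (1 - b ^+ 2) * r ^+ 2.
  have b1 : 0 < 1 - b ^+ 2 by have := sqr_ge0 b; lra.
  rewrite -ltr_pdivrMl// mulrC; set X := (X in X < _).
  have X0 : 0 <= X by rewrite /X divr_ge0 ?(ltW b1)// -exprMn addr_ge0 ?sqr_ge0.
  rewrite -[ltLHS]sqr_sqrtr// ltr_pXn2r ?nnegrE ?sqrtr_ge0 ?(ltW r0)//.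
  move: q1; rewrite /gap_quotient -/X ltr_pdivrMr ?subr_gt0// /r; lra.
have [kap kap1 [kb kmargin]] := gap_margin w0 b5 abr.
set B := kap * b ^+ 2 in kb kmargin.
have B0 : 0 <= B by rewrite mulr_ge0 ?sqr_ge0//; lra.
have a0 : 0 <= kap * a ^+ 2 by rewrite mulr_ge0 ?sqr_ge0//; lra.
pose x0 := (1 - B) * w.
have Bw : B * w < r.
  have : B * w ^+ 2 < r ^+ 2.
    rewrite -subr_gt0; rewrite -(pmulr_rgt0 _ (_ : 0 < 1 - B)) ?subr_gt0//.
    exact: le_lt_trans kmargin.
  move=> h; rewrite -(@ltr_pXn2r _ 2) ?nnegrE ?(ltW r0)//; last first.
    by rewrite mulr_ge0//; case/andP: w0.
  apply: le_lt_trans h; rewrite exprMn ler_wpM2r ?sqr_ge0// expr2 ler_piMl//.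
  exact: ltW.
have x0al : al < x0 by rewrite /x0; lra.
have x0be : x0 < be.
  rewrite /x0; have : 0 <= B * w by rewrite mulr_ge0//; case/andP: w0.
  by lra.
have Tx0 : resolvent_set T x0%:C by apply: gap; rewrite /strip /= x0al.
have [M M0 TM] := resolvent_bounded_below Tx0.
have Tw : forall u, dom T u -> r * nrm u <= nrm (T u - w%:C *: u).
  by apply: (normal_bounded_below dot_norm T_normal r0); rewrite wr1 wr2.
pose k0 := Num.sqrt kap^-1.
have kap0 : 0 < kap by lra.
have k00 : 0 <= k0 by exact: sqrtr_ge0.
have k01 : k0 < 1.
  by rewrite -[ltRHS]sqrtr1 ltr_sqrt// invf_lt1.
have Ak u : dom T u -> nrm (A u) <= k0 * nrm (T u - x0%:C *: u).
  move=> Tu; rewrite -(@ler_pXn2r _ 2) ?nnegrE ?mulr_ge0// exprMn.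
  rewrite sqr_sqrtr ?invr_ge0 ?(ltW kap0)// ler_pdivlMl// rnorm_shift_identity.
  have := ler_wpM2l (ltW kap0) (Abound _ Tu) => /le_trans; apply.
  have h0 : r ^+ 2 * nrm u ^+ 2 <= nrm (T u - w%:C *: u) ^+ 2.
    have ru0 : 0 <= r * nrm u by rewrite mulr_ge0// ltW.
    by rewrite -exprMn ler_pXn2r ?nnegrE ?Tw.
  have B1 : 0 <= 1 - B by rewrite subr_ge0 ltW.
  have h1 := ler_wpM2l B1 h0.
  have h2 := ler_wpM2r (sqr_ge0 (nrm u)) (ltW kmargin).
  have E : kap * (a ^+ 2 * nrm u ^+ 2 + b ^+ 2 * nrm (T u) ^+ 2) =
    kap * a ^+ 2 * nrm u ^+ 2 + B * nrm (T u) ^+ 2 by rewrite /B; ring.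
  rewrite E; move: h1 h2; set P := nrm (_ - _) ^+ 2; lra.
pose e := minr ((1 - k0) / (4 * M)) (minr (x0 - al) (be - x0)).
have e0 : 0 < e by rewrite !lt_min !subr_gt0 x0al x0be divr_gt0 ?mulr_gt0 ?subr_gt0.
have e1 : e <= (1 - k0) / (4 * M) by rewrite ge_min lexx.
have e2 : e <= x0 - al by rewrite !ge_min lexx !orbT.
have e3 : e <= be - x0 by rewrite !ge_min lexx !orbT.
exists (x0 - e), (x0 + e), e; split=> //; try lra.
move=> z [/andP[z1 z2] /andP[z3 z4]].
have eM : e * M <= (1 - k0) / 4.
  by rewrite -ler_pdivlMr//; apply: (le_trans e1); rewrite invfM mulrA.
apply: (@resolvent_perturbation _ _ _ _ x0%:C _ ((1 + k0) / 2)) => //.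
  by apply/andP; split; lra.
move=> u Tu; apply: (le_trans (rnorm_triangle _ _)); rewrite rnormN rnormZ.
have zx : complex.Re `|z - x0%:C| <= 2 * e.
  apply: (le_trans (Re_norm_le _)); rewrite !raddfB /= subr0.
  have : `|complex.Re z - x0| <= e by rewrite ler_distl; apply/andP; split; lra.
  have : `|complex.Im z| <= e by rewrite ler_norml; apply/andP; split; lra.
  by lra.
have h1 := Ak _ Tu; have h2 := TM _ Tu.
have h3 := ler_wpM2r (n0 u) zx.
have h4 := ler_wpM2l (ltW e0) h2.
have h5 := ler_wpM2r (n0 (T u - x0%:C *: u)) eM.
rewrite /nrm in h1 h2 h3 h4 h5 *; lra.
Qed.

End Gap.

(* H is a complex Hilbert space: it is complete, and by dot_norm its norm is
   the one of the inner product dot.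
   For a = b = 0 the quotients are all 0 whatever the gap lengths are, so in
   the two equivalences for b = 0 the implication towards the gap lengths is
   only claimed for 0 < a. *)
Theorem theorem5p5 (R : realType) (H : completeNormedModType R[i])
    (dot : {dot H for conjC})
    (dot_norm : forall x : H, dot x x = `|x| ^+ 2)
    (T A : operator H) (a b : R) (alpha beta : R^nat)
    (T_normal : normal_operator dot T)
    (A_linear : linear_operator A)
    (dom_TA : dom T `<=` dom A)
    (a_ge0 : 0 <= a)
    (b_ge0 : 0 <= b)
    (b_lt : b < 1 / Num.sqrt 5)
    (A_bound : forall x : H, dom T x ->
       `|A x| ^+ 2 <= (a ^+ 2)%:C * `|x| ^+ 2 + (b ^+ 2)%:C * `|T x| ^+ 2)
    (alpha_unbounded : ~ bounded_fun alpha)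
    (beta_unbounded : ~ bounded_fun beta)
    (alpha_lt_beta : forall n : nat, alpha n < beta n)
    (beta_le_alpha : forall n : nat, beta n <= alpha n.+1)
    (gaps : forall n : nat, strip (alpha n) (beta n) `<=` resolvent_set T) :
  let q := fun n : nat => gap_quotient a b (alpha n) (beta n) in
  let c := 1 + 2 * b / (Num.sqrt (1 - b ^+ 2) - 2 * b) in
  ( ((limn_einf (fun n => (q n)%:E) < 1%:E)%E ->
       infinite_set
         [set n | gap_survives (add_operator T A) (alpha n) (beta n)])
    /\ (b = 0 ->
         ((limn_esup (fun n => (beta n - alpha n)%:E) > (2 * a)%:E)%E ->
            (limn_einf (fun n => (q n)%:E) < 1%:E)%E)
         /\ (0 < a ->
            (limn_einf (fun n => (q n)%:E) < 1%:E)%E ->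
            (limn_esup (fun n => (beta n - alpha n)%:E) > (2 * a)%:E)%E))
    /\ (0 < b ->
         ((limn_einf (fun n => (q n)%:E) < 1%:E)%E <->
          (limn_esup (fun n => (beta n / alpha n)%:E) > c%:E)%E)) )
  /\
  ( ((limn_esup (fun n => (q n)%:E) < 1%:E)%E ->
       finite_set
         [set n | ~ gap_survives (add_operator T A) (alpha n) (beta n)])
    /\ (b = 0 ->
         ((limn_einf (fun n => (beta n - alpha n)%:E) > (2 * a)%:E)%E ->
            (limn_esup (fun n => (q n)%:E) < 1%:E)%E)
         /\ (0 < a ->
            (limn_esup (fun n => (q n)%:E) < 1%:E)%E ->
            (limn_einf (fun n => (beta n - alpha n)%:E) > (2 * a)%:E)%E))
    /\ (0 < b ->
         ((limn_esup (fun n => (q n)%:E) < 1%:E)%E <->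
          (limn_einf (fun n => (beta n / alpha n)%:E) > c%:E)%E)) ).
Proof.
move=> q c; have b5 := sqr_bound_lt b_ge0 b_lt.
have surv : \forall n \near \oo, q n < 1 ->
    gap_survives (add_operator T A) (alpha n) (beta n).
  apply: filterS (alpha_gt_near alpha_unbounded alpha_lt_beta beta_le_alpha 0).
  move=> n an; apply: (gap_survives_perturbation dot_norm T_normal A_linear
    dom_TA b5 _ (ltW an) (alpha_lt_beta n) (gaps n)).
  move=> x /A_bound.
  by rewrite !rnormE -!rmorphXn -!rmorphM -rmorphD lecR.
have b0_from (b0 : b = 0) :=
  limn_gt_lt (length_gt_quotient_lt alpha beta a_ge0 b0).
have b0_to (b0 : b = 0) (a0 : 0 < a) :=
  limn_lt_gt (quotient_lt_length_gt a_ge0 alpha_lt_beta b0 a0).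
have b_to (b0 : 0 < b) := limn_lt_gt (quotient_lt_ratio_gt a b_ge0 b_lt
  alpha_unbounded alpha_lt_beta beta_le_alpha b0).
have b_from (b0 : 0 < b) := limn_gt_lt (ratio_gt_quotient_lt a_ge0 b_ge0 b_lt
  alpha_unbounded alpha_lt_beta beta_le_alpha b0).
split; split.
- move=> /limn_einf_ltP[y y1 oy]; apply: infinitely_often_infinite.
  apply: infinitely_oftenS oy; apply: filterS surv => n sn qn.
  exact: sn (lt_trans qn y1).
- split=> b0.
    by split=> [|a0]; [case: (b0_from b0)|case: (b0_to b0 a0)].
  by split; [case: (b_to b0)|case: (b_from b0)].
- move=> /limn_esup_ltP[y y1 qy]; apply: eventually_finite.
  apply: filterS2 surv qy => n sn qn; exact: sn (lt_trans qn y1).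
- split=> b0.
    by split=> [|a0]; [case: (b0_from b0)|case: (b0_to b0 a0)].
  by split; [case: (b_to b0)|case: (b_from b0)].
Qed.
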